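(* Let $\mathcal{F} = \{ c_i + K : i=1,2,\ldots, n\}$ be a totally separable packing of $n$ translates of the convex domain $K$ in $\mathbb{E}^2$. Let $C = \operatorname{conv} \{ c_1,c_2,\ldots, c_n \}$. (1) Then $$\operatorname{area} \left(\operatorname{conv} \left( \bigcup_{i=1}^n (c_i+K) \right)\right) = \operatorname{area} (C+K)\geq \frac{2}{3} (n-1)\operatorname{area} \left(\square(K)\right) + \operatorname{area} (K)+\frac{1}{3} \operatorname{area}(C).$$ (2) If $K$ or $C$ is centrally symmetric, then $$\operatorname{area} (C+K)\geq (n-1) \operatorname{area} \left(\square(K)\right) + \operatorname{area} (K).$$
   Context: $\mathbb{E}^2$ is the Euclidean plane. A convex domain is a compact convex set with non-empty interior in $\mathbb{E}^2$. A family of translates of $K$ is a packing if no two members have an interior point in common; a packing $\mathcal F$ of translates of $K$ is totally separable if any two members of $\mathcal F$ can be separated by a line which is disjoint from the interiors of all members of $\mathcal F$. $\operatorname{conv}$ denotes convex hull, $C+K$ is the Minkowski sum, and $\square(K)$ denotes a minimal area parallelogram circumscribed about $K$. *)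

(* Defs.v *)
From mathcomp Require Export all_boot all_order all_algebra.
From mathcomp Require Export all_classical all_reals all_analysis.

Set Implicit Arguments.
Unset Strict Implicit.
Unset Printing Implicit Defensive.

Export Order.TTheory GRing.Theory Num.Theory numFieldNormedType.Exports.
Local Open Scope classical_set_scope.
Local Open Scope ring_scope.

(* The topology is induced by the library's sup norm on pairs; it is the
   Euclidean one. *)
Notation plane R := (R * R)%type.

Section Plane.
Context {R : realType}.
Implicit Types (x u v p : plane R) (A B K Q : set (plane R)).

Definition area A : \bar R :=
  (product_measure1 (@lebesgue_measure R) (@lebesgue_measure R)) A.

Definition convex_hull A : set (plane R) :=
  smallest (@convex_set R (plane R)) A.

Definition minkowski_sum A B : set (plane R) := [set a + b | a in A & b in B].

Definition translate x A : set (plane R) := [set x + a | a in A].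

Definition convex_domain K : Prop :=
  [/\ compact K, @convex_set R (plane R) K & K° !=set0].

Definition centrally_symmetric A : Prop :=
  exists p, forall x, A x -> A (p *+ 2 - x).

Definition dot u x : R := u.1 * x.1 + u.2 * x.2.

Definition packing (I : Type) (F : I -> set (plane R)) : Prop :=
  forall i j, i <> j -> (F i)° `&` (F j)° = set0.

(* The separating line is [{x | dot u x = b}]. *)
Definition totally_separable (I : Type) (F : I -> set (plane R)) : Prop :=
  forall i j, i <> j -> exists u, exists b : R,
    [/\ u != 0,
        F i `<=` [set x | dot u x <= b],
        F j `<=` [set x | b <= dot u x] &
        forall k, [set x | dot u x = b] `&` (F k)° = set0].

Definition segment p u : set (plane R) :=
  [set p + s *: u | s in `[0, 1]].

Definition parallelogram p u v : set (plane R) :=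
  [set p + s *: u + t *: v | s in `[0, 1] & t in `[0, 1]].

(* A circumscribed parallelogram contains [K] and each of its four sides
   touches [K]. *)
Definition circumscribed_parallelogram K Q : Prop :=
  exists p u v,
    [/\ u.1 * v.2 - u.2 * v.1 != 0,
        Q = parallelogram p u v,
        K `<=` Q,
        (segment p u `&` K !=set0) /\ (segment (p + v) u `&` K !=set0) &
        (segment p v `&` K !=set0) /\ (segment (p + u) v `&` K !=set0)].

Definition min_area_circumscribed_parallelogram K Q : Prop :=
  circumscribed_parallelogram K Q /\
  forall Q', circumscribed_parallelogram K Q' -> (area Q <= area Q')%E.

End Plane.

(* Main.v *)
Require Import Defs.
From mathcomp Require Import ring lra measurable_realfun.
Local Open Scope classical_set_scope.
Local Open Scope ring_scope.

(** Write -K for the reflected body, C for the hull of the centres and q for the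
    area of Q.  The theorem combines two inequalities of opposite nature.

    A lower bound for the symmetrised area ([separable_bound]): for every
    compact convex C containing the n centres,
      area (C + K) + area (C - K) >= 2 (n - 1) q + 2 area K.
    It is proved by induction on n.  A line separating two members misses every
    interior, hence divides the family into two smaller ones.  The centres of
    the translates whose interior would meet the line form a strip, and the
    parts C1 and C2 of C on its two sides contain the centres of the two
    subfamilies.  The strip is as wide as K, so C1 + K and C2 + K do not
    overlap, and the induction needs only that the part of C + K outside them,
    plus the same part for -K, has area at least 2 q - 2 area K
    ([halfplane_cut_area]).  Let the separating line be vertical.  The lower and
    the upper side of C over the strip are replaced by the chords between their
    end points, and K is inscribed in the trapezoid U bounded by its two
    vertical supporting lines, its lower supporting line parallel to the lower
    chord and its upper one parallel to the upper chord.  The complement of K in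
    U falls into four gaps, separated by K and by the points where the slanted
    sides touch K; moved by the four end points of the chords, they lie in C +
    K, outside C1 + K and C2 + K, and do not overlap ([strip_cut_area]).  This
    gains area U - area K.  The trapezoids of K and of -K together have area at
    least 2 w d, where w is the width of K and d the length of its longest
    vertical chord ([strip_cut_reflected]).  Finally K has parallel supporting
    lines at the ends of that chord ([longest_chord]), which give a
    circumscribed parallelogram of area w d, so that w d >= q.

    If K or C is centrally symmetric, then C - K has the same area as C + K
    ([areaR_symmetric]) and the second inequality of the theorem follows.

    In general the two areas are compared ([reflection_bound]):
      2 area (C + K) >= area C + area K + area (C - K).
    In terms of mixed areas this is V (C, -K) <= 2 V (C, K), and the reason is
    that a triangle T of largest area in K satisfies, up to translation, T <= K
    and -K <= 2 T.  Mixed areas are avoided: area (C + L) - area L increases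
    with the convex set L ([minkowski_area_increment]), and the only instance of
    polynomiality which is needed, for L equal to T and to 2 T, is read off from
    the division of 2 T into a parallelogram and two copies of T
    ([corner_double]).  One third of this comparison and one third of the lower
    bound add up to the first inequality of the theorem. *)

Set Implicit Arguments.
Unset Strict Implicit.
Unset Printing Implicit Defensive.

Local Notation convex A := (@convex_set _ (plane _) A).

(** * Convexity and compactness in the plane *)

Section Basics.
Context {R : realType}.
Implicit Types (p q u x y z : plane R) (A B K L : set (plane R)).

Lemma convex_setP A : convex A <->
  forall p q (t : R), A p -> A q -> 0 <= t -> t <= 1 ->
    A (t *: p + (1 - t) *: q).
Proof.
split=> [cA p q t Ap Aq t0 t1|cA p q t Ap Aq].
  have t01 : t \in `[0, 1] by rewrite in_itv/= t0.
  have := cA p q (Itv01 t0 t1) (mem_set Ap) (mem_set Aq).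
  by rewrite inE.
move: Ap Aq; rewrite !inE => Ap Aq; apply: cA => //.
Qed.

Lemma convex_at A p q z (t : R) : convex A ->
  A p -> A q -> 0 <= t -> t <= 1 ->
  z.1 = t * p.1 + (1 - t) * q.1 -> z.2 = t * p.2 + (1 - t) * q.2 -> A z.
Proof.
move=> /convex_setP cA Ap Aq t0 t1 z1 z2.
suff -> : z = t *: p + (1 - t) *: q by exact: cA.
by case: z z1 z2 => [a b] /= -> ->.
Qed.

Lemma plane_continuous2 (f g : plane R -> R) : continuous f -> continuous g ->
  continuous (fun p => (f p, g p) : plane R).
Proof. by move=> cf cg p; apply: (cvg_pair (cf p) (cg p)). Qed.

Lemma fst_continuous : continuous (fun p : plane R => p.1).
Proof. by move=> p; exact: cvg_fst. Qed.

Lemma snd_continuous : continuous (fun p : plane R => p.2).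
Proof. by move=> p; exact: cvg_snd. Qed.

Lemma affine_continuous (a b c : R) : continuous (fun p : plane R => a * p.1 + b * p.2 + c).
Proof.
move=> p; apply: cvgD; last exact: cvg_cst.
by apply: cvgD; apply: cvgM; (try exact: cvg_cst); [exact: fst_continuous|exact: snd_continuous].
Qed.

Lemma plane_hausdorff : hausdorff_space (plane R).
Proof. exact: (@norm_hausdorff R (R * R)%type). Qed.

Lemma plane_compact_closed A : compact A -> closed A.
Proof. exact: (compact_closed plane_hausdorff). Qed.

Lemma compact_image A (f : plane R -> plane R) : compact A -> continuous f -> compact (f @` A).
Proof.
by move=> cA cf; apply: continuous_compact => //; exact: continuous_subspaceT.
Qed.

Lemma compact_minkowski A B : compact A -> compact B -> compact (minkowski_sum A B).
Proof.
move=> cA cB.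
have -> : minkowski_sum A B = (fun u : plane R * plane R => u.1 + u.2) @` (A `*` B).
  apply/seteqP; split=> [_ [a Aa [b Bb <-]]|_ [[a b] [/= Aa Bb] <-]].
    by exists (a, b).
  by exists a => //; exists b.
apply: continuous_compact; last exact: compact_setX.
apply: continuous_subspaceT => u; apply: (@cvgD _ (plane R)); [exact: cvg_fst|exact: cvg_snd].
Qed.

Lemma compact_argmax A (f : plane R -> R) : A !=set0 -> compact A -> continuous f ->
  exists2 p, A p & forall q, A q -> f q <= f p.
Proof.
move=> A0 cA cf.
have [p] := compact_EVT_max A0 cA (continuous_subspaceT cf).
rewrite inE => Ap H; exists p => // q Aq; apply: H; exact: mem_set.
Qed.

Lemma compact_argmin A (f : plane R -> R) : A !=set0 -> compact A -> continuous f ->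
  exists2 p, A p & forall q, A q -> f p <= f q.
Proof.
move=> A0 cA cf.
have [p] := compact_EVT_min A0 cA (continuous_subspaceT cf).
rewrite inE => Ap H; exists p => // q Aq; apply: H; exact: mem_set.
Qed.

Lemma plane_bounded A : compact A -> exists2 M : R, 0 < M &
  forall p, A p -> `|p.1| <= M /\ `|p.2| <= M.
Proof.
move=> cA; have [M [Mr HM]] := compact_bounded (V := (R * R)%type) cA.
exists (Num.max M 0 + 1); first by rewrite ltr_wpDl // le_max lexx orbT.
move=> p Ap; have : `|p| <= Num.max M 0 + 1.
  by apply: HM => //; rewrite (@le_lt_trans _ _ (Num.max M 0)) ?le_max ?lexx// ltrDl.
by rewrite prod_normE ge_max => /andP[].
Qed.

(** The measurable sets here are those of the product sigma-algebra: an open set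
    is a countable union of rational squares. *)
Lemma open_plane_measurable A : open A -> measurable A.
Proof.
move=> oA.
pose I := (rat * rat * rat)%type.
pose box (i : I) : set (plane R) :=
  ball (ratr i.1.1 : R) (ratr i.2 : R) `*` ball (ratr i.1.2 : R) (ratr i.2 : R).
have -> : A = \bigcup_(i in [set i : I | box i `<=` A]) box i.
  apply/seteqP; split => [p Ap|p [i /= iA]]; last exact: iA.
  have /nbhs_ballP[e /= e0 eA] := open_nbhs_nbhs (conj oA Ap).
  have [r rb] := @rat_in_itvoo R 0 (e / 2) ltac:(by rewrite divr_gt0).
  have [|q1 q1b] := @rat_in_itvoo R (p.1 - ratr r) (p.1 + ratr r).
    by move: rb; rewrite in_itv/= => /andP[] *; lra.
  have [|q2 q2b] := @rat_in_itvoo R (p.2 - ratr r) (p.2 + ratr r).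
    by move: rb; rewrite in_itv/= => /andP[] *; lra.
  move: rb q1b q2b; rewrite !in_itv/= => /andP[r0 r1] /andP[a1 a2] /andP[b1 b2].
  exists (q1, q2, r).
    move=> z [/=]; rewrite /ball/= => z1 z2; apply: eA; split; rewrite /ball/=.
      by move: z1; rewrite !ltr_norml => /andP[] *; apply/andP; split; lra.
    by move: z2; rewrite !ltr_norml => /andP[] *; apply/andP; split; lra.
  by split; rewrite /ball/= ltr_norml; apply/andP; split; lra.
rewrite bigcup_mkcond; apply: countable_bigcupT_measurable => [|i].
  exact: countableP.
case: ifPn => _; last exact: measurable0.
by apply: measurableX; exact: measurable_ball.
Qed.

Lemma closed_plane_measurable A : closed A -> measurable A.
Proof.
move=> cA; rewrite -(setCK A); apply: measurableC; apply: open_plane_measurable.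
exact: closed_openC.
Qed.

Lemma compact_plane_measurable A : compact A -> measurable A.
Proof. by move/plane_compact_closed/closed_plane_measurable. Qed.

Lemma plane_eq p q : p.1 = q.1 -> p.2 = q.2 -> p = q.
Proof. by case: p q => [? ?] [? ?] /= -> ->. Qed.

Lemma dotD u p q : dot u (p + q) = dot u p + dot u q.
Proof. by rewrite /dot /=; ring. Qed.

Lemma dotZ u (s : R) p : dot u (s *: p) = s * dot u p.
Proof. by rewrite /dot /= /GRing.scale /=; ring. Qed.

Lemma dotN u p : dot (- u) p = - dot u p.
Proof. by rewrite /dot /=; ring. Qed.

Lemma dot_continuous u : continuous (dot u).
Proof.
have -> : dot u = (fun p : plane R => u.1 * p.1 + u.2 * p.2 + 0).
  by apply/funext => p; rewrite addr0.
exact: affine_continuous.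
Qed.

Lemma dot_self_gt0 u : u != 0 -> 0 < dot u u.
Proof.
move=> u0; rewrite /dot lt_neqAle addr_ge0 ?sqr_ge0// andbT eq_sym paddr_eq0 ?sqr_ge0//.
apply: contraNN u0; rewrite !mulf_eq0 !orbb => /andP[/eqP u1 /eqP u2].
by apply/eqP; exact: plane_eq.
Qed.

Lemma convex_minkowski A B : convex A -> convex B ->
  convex (minkowski_sum A B).
Proof.
move=> /convex_setP vA /convex_setP vB.
apply/convex_setP => _ _ s [x Ax [y By <-]] [x' Ax' [y' By' <-]] s0 s1.
exists (s *: x + (1 - s) *: x'); first exact: vA.
exists (s *: y + (1 - s) *: y'); first exact: vB.
by rewrite !scalerDr addrACA.
Qed.

End Basics.

(** * Area under affine maps *)

Section Area.
Context {R : realType}.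
Implicit Types (p q : plane R) (A B K L : set (plane R)).
Local Notation leb := (@lebesgue_measure R).

Lemma lebesgue_measure_image_pos (r s : R) (S : set R) : 0 < r -> measurable S ->
  leb ((fun y => r * y + s) @` S) = (r%:E * leb S)%E.
Proof.
move=> r0 mS.
pose h : measurableTypeR R -> measurableTypeR R := fun z => r^-1 * (z - s).
have mh : measurable_fun setT h.
  by apply: measurable_funM => //; apply: measurable_funB.
have r'0 : 0 <= r^-1 by rewrite invr_ge0 ltW.
have -> : (fun y => r * y + s) @` S = h @^-1` S.
  apply/seteqP; split=> [_ [y Sy <-]|z Sz] /=; rewrite /h.
    by rewrite addrK mulKf ?gt_eqF.
  by exists (h z) => //; rewrite /h mulVKf ?gt_eqF// subrK.
suff -> : leb S = pushforward (mscale (NngNum r'0) leb) h S.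
  by rewrite /pushforward /mscale /= muleA -EFinM mulfV ?gt_eqF// mul1e.
apply: lebesgue_measure_unique => //= _ [[a b]] _ <-.
rewrite /mscale /pushforward /=.
have -> : h @^-1` `]a, b]%classic = `](r * a + s), (r * b + s)]%classic.
  apply/seteqP; split=> z /=; rewrite !in_itv /= /h => /andP[H1 H2].
    by move: H1 H2; rewrite -(ltr_pM2l r0) mulVKf ?gt_eqF// -[_ <= b](ler_pM2l r0) mulVKf ?gt_eqF// => *;
      apply/andP; split; lra.
  by rewrite -(ltr_pM2l r0) -[X in _ && X](ler_pM2l r0) mulVKf ?gt_eqF//; apply/andP; split; lra.
rewrite !lebesgue_measure_itv /= !lte_fin ltrD2r ltr_pM2l//.
case: ifPn => _; last by rewrite mule0.
by rewrite -!EFinB -EFinM; congr EFin; field; rewrite gt_eqF.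
Qed.

Lemma lebesgue_measure_image (r s : R) (S : set R) : r != 0 -> measurable S ->
  leb ((fun y => r * y + s) @` S) = (`|r|%:E * leb S)%E.
Proof.
move=> rn0 mS; have [r0|r0|r0] := ltgtP 0 r; last by rewrite -r0 eqxx in rn0.
  by rewrite gtr0_norm// lebesgue_measure_image_pos.
rewrite ltr0_norm//.
have mNS : measurable ((-%R : _ -> measurableTypeR R) @^-1` S).
  by rewrite -[X in measurable X]setTI; apply: (oppr_measurable measurableT).
rewrite -[in RHS](lebesgue_measureN mS) /pushforward.
rewrite -(lebesgue_measure_image_pos s _ mNS) ?oppr_gt0//; congr leb.
apply/seteqP; split=> [_ [y Sy <-]|_ [y Sy <-]].
  by exists (- y); rewrite /= ?opprK//; ring.
by exists (- y) => //; ring.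
Qed.

(** The affine maps preserving vertical lines; together with the exchange of
    coordinates they generate the invertible ones. *)
Definition fiber_affine (r s t : R) (p : plane R) : plane R :=
  (p.1, r * p.2 + (s * p.1 + t)).

Definition swap_plane (p : plane R) : plane R := (p.2, p.1).

Lemma swap_planeK : involutive swap_plane. Proof. by case. Qed.

Lemma measurable_swap_image A : measurable A -> measurable (swap_plane @` A).
Proof.
move=> mA; have -> : swap_plane @` A = swap_plane @^-1` A.
  apply/seteqP; split=> [_ [p Ap <-]|p Ap]; first by rewrite /= swap_planeK.
  by exists (swap_plane p); rewrite ?swap_planeK.
have mf : measurable_fun setT swap_plane by apply: measurable_fun_pair.
by rewrite -[X in measurable X]setTI; exact: mf.
Qed.

Lemma measurable_fiber_image (r s t : R) A : r != 0 -> measurable A ->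
  measurable (fiber_affine r s t @` A).
Proof.
move=> r0 mA; pose g p : plane R := (p.1, r^-1 * (p.2 - (s * p.1 + t))).
have -> : fiber_affine r s t @` A = g @^-1` A.
  apply/seteqP; split=> [_ [[u v] Ap <-]|[u v] Ap].
    by rewrite /= /g /fiber_affine/= addrK mulKf.
  by exists (g (u, v)) => //; rewrite /fiber_affine /g/= mulVKf// subrK.
have mf : measurable_fun setT g.
  apply: measurable_fun_pair => //.
  apply: measurable_funM => //; apply: measurable_funB => //.
  by apply: measurable_funD => //; apply: measurable_funM.
by rewrite -[X in measurable X]setTI; exact: mf.
Qed.

(** Fubini: every vertical section is scaled by [r]. *)
Lemma area_fiber_affine (r s t : R) A : r != 0 -> measurable A ->
  area (fiber_affine r s t @` A) = (`|r|%:E * area A)%E.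
Proof.
move=> r0 mA; rewrite /area /product_measure1.
rewrite -ge0_integralZl//; last exact: measurable_fun_xsection.
apply: eq_integral => x _ /=.
rewrite -(lebesgue_measure_image (s * x + t)) //; last exact: measurable_xsection.
congr leb; apply/seteqP; split=> [y|_ [y + <-]]; rewrite /xsection/= inE.
  by move=> [[u v] Auv [<- <-]] /=; exists v => //=; rewrite inE.
by move=> Axy; rewrite inE; exists (x, y).
Qed.

(** The two orders of integration define the same product measure. *)
Lemma area_swap A : measurable A -> area (swap_plane @` A) = area A.
Proof.
move=> mA; rewrite {1}/area.
rewrite (product_measure_unique (m' := (leb \x^ leb)%E)); last exact: measurable_swap_image.
  rewrite /area /product_measure1 /product_measure2.
  apply: eq_integral => x _ /=; congr leb.
  apply/seteqP; split=> y; rewrite /xsection/ysection/= !inE.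
    by move=> [[u v] Auv [<- <-]].
  by exists (x, y).
by move=> B C mB mC; exact: (product_measure2E leb leb mB mC).
Qed.

Definition affine_map (a b c d e f : R) (p : plane R) : plane R :=
  (a * p.1 + b * p.2 + e, c * p.1 + d * p.2 + f).

(** Gaussian elimination: an affine map with non-zero pivot [a] is a product of
    two vertical-line preserving maps and two exchanges of coordinates; if the
    pivot vanishes, one more exchange makes it non-zero. *)
Lemma area_affine_map (a b c d e f : R) A :
  a * d - b * c != 0 -> measurable A ->
  area (affine_map a b c d e f @` A) = (`|a * d - b * c|%:E * area A)%E.
Proof.
wlog a0 : a b c d A / a != 0.
  move=> H D mA; have [a0|a0] := eqVneq a 0; last exact: H.
  have b0 : b != 0 by apply: contraNneq D => ->; rewrite a0; apply/eqP; ring.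
  have -> : affine_map a b c d e f @` A = affine_map b a d c e f @` (swap_plane @` A).
    rewrite image_comp; apply: eq_imagel => p _.
    by rewrite /affine_map /=; congr pair; ring.
  rewrite H ?area_swap//; last exact: measurable_swap_image.
    by rewrite -(normrN (b * c - a * d)); congr (_%:E * _)%E; congr `|_|; ring.
  by apply: contraNneq D => E; apply/eqP; rewrite -[LHS]opprK -[RHS]oppr0 -E; ring.
move=> D mA.
have d'0 : d - b * c / a != 0.
  by apply: contraNneq D => E; apply/eqP; transitivity (a * (d - b * c / a)); [field|rewrite E mulr0].
have -> : affine_map a b c d e f @` A =
  fiber_affine (d - b * c / a) (c / a) (f - c * e / a) @`
   (swap_plane @` (fiber_affine a b e @` (swap_plane @` A))).
  rewrite !image_comp; apply: eq_imagel => p _.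
  by rewrite /affine_map /fiber_affine /=; congr pair; [ring|field].
have m1 := measurable_swap_image mA.
have m2 := measurable_fiber_image b e a0 m1.
have m3 := measurable_swap_image m2.
rewrite (area_fiber_affine _ _ d'0 m3) (area_swap m2) (area_fiber_affine _ _ a0 m1) (area_swap mA).
by rewrite muleA -EFinM -normrM; congr (`|_|%:E * _)%E; field.
Qed.

Lemma affine_map_continuous (a b c d e f : R) : continuous (affine_map a b c d e f).
Proof. by apply: plane_continuous2; exact: affine_continuous. Qed.

Lemma affine_map_convex (a b c d e f : R) A :
  convex A -> convex (affine_map a b c d e f @` A).
Proof.
move=> /convex_setP cA; apply/convex_setP => _ _ t [p Ap <-] [q Aq <-] t0 t1.
exists (t *: p + (1 - t) *: q); first exact: cA.
by rewrite /affine_map; congr pair => /=; rewrite /GRing.scale/=; ring.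
Qed.

Lemma translateE (x : plane R) A : translate x A = affine_map 1 0 0 1 x.1 x.2 @` A.
Proof.
apply: eq_imagel => p _; case: x p => [u v] [u' v']; rewrite /affine_map /=.
by congr pair => /=; ring.
Qed.

Lemma measurable_translate (x : plane R) A : measurable A -> measurable (translate x A).
Proof.
move=> mA; pose g p : plane R := (p.1 - x.1, p.2 - x.2).
have -> : translate x A = g @^-1` A.
  apply/seteqP; split=> [_ [[u v] Ap <-]|[u v] Ap].
    by case: x @g => [x1 x2]; rewrite /= !(addrAC _ _ (- _)) !subrr !add0r.
  exists (g (u, v)) => //; case: x @g Ap => [x1 x2] /= _.
  by congr pair => /=; ring.
have mf : measurable_fun setT g.
  by apply: measurable_fun_pair; apply: measurable_funB.
by rewrite -[X in measurable X]setTI; exact: mf.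
Qed.

Lemma area_translate (x : plane R) A : measurable A -> area (translate x A) = area A.
Proof.
move=> mA; rewrite translateE area_affine_map// mulr1 mulr0 subr0 ?oner_eq0//.
by rewrite normr1 mul1e.
Qed.

Lemma area_ge0 A : (0 <= area A)%E.
Proof. exact: measure_ge0. Qed.

Lemma le_area A B : measurable A -> measurable B -> A `<=` B -> (area A <= area B)%E.
Proof. by move=> mA mB AB; apply: le_measure; rewrite ?inE. Qed.

Lemma area_vline (a : R) : area [set p | p.1 = a] = 0%E.
Proof.
have -> : [set p : plane R | p.1 = a] = [set a] `*` setT.
  by apply/seteqP; split=> p /=; rewrite /setX/=; [move=> ->|case].
rewrite /area product_measure1E//.
by rewrite [X in (X * _)%E](_ : _ = 0%E) ?mul0e//; exact: lebesgue_measure_set1.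
Qed.

Lemma compact_area_fin A : compact A -> (area A < +oo)%E.
Proof.
move=> cA; have [M M0 HM] := plane_bounded cA.
apply: (@le_lt_trans _ _ (area (`[- M, M]%classic `*` `[- M, M]%classic))).
  apply: le_area; [exact: compact_plane_measurable| exact: measurableX|].
  move=> p /HM[p1 p2]; split; rewrite /= in_itv/=.
    by move: p1; rewrite ler_norml.
  by move: p2; rewrite ler_norml.
rewrite /area product_measure1E//= lebesgue_measure_itv/=.
by case: ifP => _; rewrite -?EFinB -EFinM ltry.
Qed.

End Area.

(** * Area of a trapezoid *)

Section Trap.
Context {R : realType}.
Implicit Types (p q : plane R) (A B K L : set (plane R)).
Local Notation leb := (@lebesgue_measure R).

Lemma integral_affine (s c a b : R) : a < b ->
  (\int[leb]_(x in `[a, b]) (s * x + c)%:E =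
   ((b - a) * (s * (a + b) / 2 + c))%:E)%E.
Proof.
move=> ab; pose F x : R := s / 2 * x ^+ 2 + c * x.
have dF (x : R) : is_derive x (1 : R) F (s * x + c).
  by apply: is_derive_eq; rewrite /GRing.scale /= !mulr1; field.
have cF : continuous F.
  by move=> y; apply: differentiable_continuous; apply/derivable1_diffP; exact: ex_derive.
have HF : (b - a) * (s * (a + b) / 2 + c) = F b - F a by rewrite /F; field.
rewrite HF EFinB.
apply: (@continuous_FTC2 _ (fun x => s * x + c) F _ _ ab).
- apply: continuous_subspaceT => y; apply: cvgD; last exact: cvg_cst.
  by apply: cvgM; [exact: cvg_cst|exact: cvg_id].
- split.
  + by move=> y _; exact: ex_derive.
  + by apply: cvg_at_right_filter; exact: cF.
  + by apply: cvg_at_left_filter; exact: cF.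
- by move=> y _; rewrite derive1E; exact: derive_val.
Qed.

Definition trapezoid (a b l u r v : R) : set (plane R) :=
  [set p | [/\ a <= p.1, p.1 <= b, l * p.1 + u <= p.2 & p.2 <= r * p.1 + v]].

Lemma closed_halfplane (a b c : R) : closed [set p : plane R | a * p.1 + b * p.2 <= c].
Proof.
have -> : [set p : plane R | a * p.1 + b * p.2 <= c] =
   (fun p : plane R => a * p.1 + b * p.2 + 0) @^-1` [set x | x <= c].
  by apply/seteqP; split => p /=; rewrite addr0.
apply: preimage_closed; last exact: closed_le.
by move=> p _; exact: affine_continuous.
Qed.

Lemma measurable_trapezoid (a b l u r v : R) : measurable (trapezoid a b l u r v).
Proof.
have -> : trapezoid a b l u r v =
  [set p : plane R | -1 * p.1 + 0 * p.2 <= - a] `&` [set p : plane R | 1 * p.1 + 0 * p.2 <= b]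
  `&` [set p : plane R | l * p.1 + (-1) * p.2 <= - u] `&` [set p : plane R | - r * p.1 + 1 * p.2 <= v].
  apply/seteqP; split=> p /=; first by move=> [*]; repeat split; lra.
  by move=> [[[? ?] ?] ?]; split; lra.
by do 3?[apply: measurableI]; apply: closed_plane_measurable; exact: closed_halfplane.
Qed.

Lemma area_trapezoid (a b l u r v : R) : a < b ->
  l * a + u <= r * a + v -> l * b + u <= r * b + v ->
  area (trapezoid a b l u r v) = ((b - a) * ((r - l) * (a + b) / 2 + (v - u)))%:E.
Proof.
move=> ab ha hb; rewrite -(integral_affine (r - l) (v - u) ab) /area /product_measure1.
rewrite [RHS]integral_mkcond; apply: eq_integral => x _ /=; rewrite patchE.
case: ifPn => [|xab].
  rewrite inE/= in_itv/= => /andP[ax xb].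
  have -> : xsection (trapezoid a b l u r v) x = `[l * x + u, r * x + v]%classic.
    apply/seteqP; split=> y; rewrite /xsection/= inE /= in_itv/=.
      by move=> [_ _ /= -> ->].
    by move=> /andP[? ?]; split.
  have hx : l * x + u <= r * x + v.
    have := mulr_ge0 (_ : 0 <= (r * a + v - l * a - u)) (_ : 0 <= b - x).
    have := mulr_ge0 (_ : 0 <= (r * b + v - l * b - u)) (_ : 0 <= x - a).
    move=> /(_ ltac:(lra) ltac:(lra)) H1 /(_ ltac:(lra) ltac:(lra)) H2.
    by rewrite -subr_ge0 -(pmulr_rge0 _ (_ : 0 < b - a)); lra.
  rewrite lebesgue_measure_itv/= lte_fin; case: ltP => hx'.
    by rewrite -EFinB; congr EFin; ring.
  by congr EFin; lra.
have -> : xsection (trapezoid a b l u r v) x = set0.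
  apply/seteqP; split=> y //; rewrite /xsection/= inE => -[/= ax xb _ _].
  by move: xab; rewrite notin_setE /= in_itv/= ax xb.
exact: measure0.
Qed.

End Trap.

(** * Vertical slices of a convex set *)

Section Slab.
Context {R : realType}.
Implicit Types (p q : plane R) (A B K L : set (plane R)).
Local Notation leb := (@lebesgue_measure R).

(** The second equation says that [z] is on the chord from [p] to [q], without
    dividing by the possibly vanishing [q.1 - p.1]. *)
Lemma between_x A p q (x : R) : convex A -> A p -> A q ->
  p.1 <= x -> x <= q.1 -> exists2 z, A z & z.1 = x /\
   (x - p.1) * (q.2 - p.2) = (q.1 - p.1) * (z.2 - p.2).
Proof.
move=> cA Ap Aq px xq; have [pq|pq] := eqVneq q.1 p.1.
  exists p => //; have -> : x = p.1 by lra.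
  by rewrite pq !subrr !mul0r.
have pq' : 0 < q.1 - p.1 by rewrite subr_gt0 lt_neqAle eq_sym pq /= (le_trans px).
pose t := (q.1 - x) / (q.1 - p.1).
have tE : t * (q.1 - p.1) = q.1 - x by rewrite /t mulfVK// gt_eqF.
have t0 : 0 <= t by apply: divr_ge0; lra.
have t1 : t <= 1 by rewrite ler_pdivrMr//; lra.
exists (x, t * p.2 + (1 - t) * q.2).
  by apply: (convex_at cA Ap Aq t0 t1) => //=; nra.
split => //=; have -> : x = q.1 - t * (q.1 - p.1) by lra.
by ring.
Qed.

Lemma between_y A (x y1 y2 y : R) : convex A -> A (x, y1) -> A (x, y2) ->
  y1 <= y -> y <= y2 -> A (x, y).
Proof.
move=> cA A1 A2 y1y yy2; have [y12|y12] := eqVneq y1 y2.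
  by have -> : y = y1 by apply/eqP; rewrite eq_le y1y y12 yy2.
have y12' : 0 < y2 - y1 by rewrite subr_gt0 lt_neqAle y12 /= (le_trans y1y).
pose t := (y2 - y) / (y2 - y1).
have tE : t * (y2 - y1) = y2 - y by rewrite /t mulfVK// gt_eqF.
have t0 : 0 <= t by apply: divr_ge0; lra.
have t1 : t <= 1 by rewrite ler_pdivrMr//; lra.
by apply: (convex_at cA A1 A2 t0 t1) => /=; nra.
Qed.

Lemma compact_cut A (a b c : R) : compact A ->
  compact (A `&` [set p | a * p.1 + b * p.2 <= c]).
Proof.
move=> cA; apply: (subclosed_compact _ cA) => [|p []//].
by apply: closedI; [exact: plane_compact_closed|exact: closed_halfplane].
Qed.

Lemma convex_cut A (a b c : R) : convex A ->
  convex (A `&` [set p | a * p.1 + b * p.2 <= c]).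
Proof.
move=> /convex_setP cA; apply/convex_setP => p q t [Ap /= hp] [Aq /= hq] t0 t1.
split; first exact: cA.
by rewrite /= /GRing.scale /=; nra.
Qed.

Lemma compact_fiber A (x : R) : compact A -> compact (A `&` [set p | p.1 = x]).
Proof.
move=> cA.
have -> : A `&` [set p | p.1 = x] =
  (A `&` [set p | 1 * p.1 + 0 * p.2 <= x]) `&` [set p | -1 * p.1 + 0 * p.2 <= - x].
  apply/seteqP; split => p /=; first by move=> [Ap ?]; repeat split => //; lra.
  by move=> [[Ap ?] ?]; split => //; lra.
by do 2!apply: compact_cut.
Qed.

Lemma fiber_interval A (x : R) : compact A -> convex A ->
  (exists2 p, A p & p.1 = x) -> exists l u : R, l <= u /\
  forall y, A (x, y) <-> l <= y <= u.
Proof.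
move=> cA vA [p Ap px].
have n0 : (A `&` [set p | p.1 = x]) !=set0 by exists p.
have cF := compact_fiber (x := x) cA.
have [[x1 l] [A1 /= E1] L] := compact_argmin n0 cF (@snd_continuous R).
have [[x2 u] [A2 /= E2] U] := compact_argmax n0 cF (@snd_continuous R).
rewrite E1 in A1; rewrite E2 in A2.
exists l, u; split; first by have := U (x, l); apply.
move=> y; split => [Ay|/andP[ly yu]]; last exact: between_y A1 A2 _ _.
by apply/andP; split; [apply: (L (x, y))|apply: (U (x, y))].
Qed.

Definition vseg : set (plane R) := [set p | p.1 = 0 /\ 0 <= p.2 <= 1].

(** Adding a vertical unit segment lengthens each non-empty vertical section by
    one. *)
Lemma area_add_vseg A (a b : R) : compact A -> convex A ->
  (exists2 p, A p & p.1 = a) -> (exists2 p, A p & p.1 = b) ->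
  (forall p, A p -> a <= p.1 <= b) ->
  area (minkowski_sum A vseg) = (area A + (b - a)%:E)%E.
Proof.
move=> cA vA [pa Aa Ea] [pb Ab Eb] Hab.
have ab : a <= b by have := Hab _ Aa; rewrite Ea => /andP[].
rewrite /area /product_measure1.
transitivity (\int[leb]_x ((leb \o xsection A) x + (\1_(`[a, b]%classic) x)%:E))%E.
  apply: eq_integral => x _ /=; rewrite indicE.
  have -> : (x \in `[a, b]%classic) = (a <= x <= b).
    by apply/idP/idP; rewrite inE /= in_itv.
  case: (boolP (a <= x <= b)) => [/andP[ax xb]|/negP xab]; last first.
    have E0 : xsection A x = set0.
      by apply/seteqP; split=> y //; rewrite /xsection/= inE => /Hab /= H; case: xab; exact: H.
    rewrite [X in leb X = _](_ : _ = set0); last first.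
      apply/seteqP; split=> y //; rewrite /xsection/= inE => -[p Ap [q [q1 _] pq]].
      have px : p.1 = x by rewrite -[x]/((x, y).1) -pq /= q1 addr0.
      by have := Hab _ Ap; rewrite px => H; case: xab; exact: H.
    rewrite [X in (_ = leb X + _)%E](_ : _ = set0); last exact: E0.
    by rewrite !measure0 add0e.
  have Ax : exists2 p, A p & p.1 = x.
    have [z Az [zx _]] := between_x vA Aa Ab (x := x) ltac:(lra) ltac:(lra).
    by exists z.
  have [l [u [lu Hlu]]] := fiber_interval cA vA Ax.
  rewrite [X in (_ = leb X + _)%E](_ : _ = `[l, u]%classic); last first.
    by apply/seteqP; split=> y; rewrite /xsection/= inE in_itv/= => /Hlu.
  rewrite [X in leb X = _](_ : _ = `[l, u + 1]%classic); last first.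
    apply/seteqP; split=> y; rewrite /xsection/= inE in_itv/=.
      move=> [[p1 p2] Ap [[q1 q2] [/= q10 /andP[? ?]] [E1 E2]]].
      have Ep : p1 = x by lra.
      by rewrite Ep in Ap; move/Hlu: Ap => /andP[? ?]; apply/andP; split; lra.
    move=> /andP[ly yu]; have [yu'|yu'] := leP y u.
      exists (x, y); first by apply/Hlu; rewrite ly.
      exists (0, 0); first by split => //=; rewrite lexx ler01.
      by congr pair => /=; rewrite addr0.
    exists (x, u); first by apply/Hlu; rewrite lu lexx.
    exists (0, y - u); first by split => //=; apply/andP; split; lra.
    by congr pair => /=; ring.
  rewrite !lebesgue_measure_itv/= !lte_fin.
  have -> : l < u + 1 by lra.
  case: ltP => lu'; first by rewrite -!EFinB -EFinD; congr EFin; ring.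
  by rewrite -EFinB add0e; congr EFin; lra.
have mA := compact_plane_measurable cA.
rewrite ge0_integralD//; last first.
- by apply/measurable_EFinP; exact: measurable_indic.
- exact: measurable_fun_xsection.
congr (_ + _)%E; rewrite integral_indic// setIT.
rewrite /= lebesgue_measure_itv/= lte_fin.
by case: ltP => [//|ba]; congr EFin; lra.
Qed.

End Slab.

(** * Gaps between a convex body and a trapezoid around it *)

Section Pieces.
Context {R : realType}.
Implicit Types (p q t z : plane R) (A B C K L : set (plane R)).

Definition below A : set (plane R) :=
  [set z | (exists2 k, A k & k.1 = z.1) /\ forall k, A k -> k.1 = z.1 -> z.2 < k.2].

Definition above A : set (plane R) :=
  [set z | (exists2 k, A k & k.1 = z.1) /\ forall k, A k -> k.1 = z.1 -> k.2 < z.2].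

(** Left of [p], the line through [q] and a point [p] that is not above [C] stays
    below [C]: otherwise a chord of [C] ending at [q] would pass below [p]. *)
Lemma chord_extension_le C p q (la : R) c : convex C ->
  C c -> C q -> c.1 <= p.1 -> p.1 < q.1 ->
  (forall c', C c' -> c'.1 = p.1 -> p.2 <= c'.2) ->
  la * (q.1 - p.1) = q.2 - p.2 -> la * (c.1 - p.1) <= c.2 - p.2.
Proof.
move=> vC Cc Cq cp pq low laE.
have [z Cz [z1 zE]] := between_x vC Cc Cq cp (ltW pq).
have := low _ Cz z1; have qc : 0 < q.1 - c.1 by lra.
move=> pz.
have : (q.1 - c.1) * p.2 <= (q.1 - c.1) * z.2 by rewrite ler_pM2l.
have pq' : 0 < q.1 - p.1 by lra.
move=> H; rewrite -(ler_pM2l pq').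
have -> : (q.1 - p.1) * (la * (c.1 - p.1)) = (q.2 - p.2) * (c.1 - p.1) by rewrite -laE; ring.
nra.
Qed.

(** [p1] and [p2] are the lowest points of [C] on the two sides of a strip of width
    [w], [la] is the slope of the chord joining them, and [t] is where the
    supporting line of slope [la] touches [K] from below.  A point [z] of the gap
    under [K] to the right of [t] is moved by [p1].  It stays in C + K, being
    between a point of the chord plus [t] and a point of p1 + K.  It is
    below C1 + K for the part C1 of [C] left of the strip: C1 is above the
    extended chord, and beyond [t] the distance of [K] from its supporting
    line increases. *)
Lemma gap_below_right C K (al w b la : R) p1 p2 t z :
  convex C -> convex K ->
  0 < w -> C p1 -> C p2 -> p1.1 = al -> p2.1 = al + w ->
  (forall c, C c -> c.1 = al -> p1.2 <= c.2) ->
  la * w = p2.2 - p1.2 ->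
  K t -> (forall k, K k -> t.2 - la * t.1 <= k.2 - la * k.1) ->
  b - w <= t.1 ->
  t.1 <= z.1 -> z.1 <= b -> t.2 - la * t.1 <= z.2 - la * z.1 -> below K z ->
  minkowski_sum C K (p1 + z) /\
  (forall c k, C c -> K k -> c.1 <= al -> c.1 + k.1 = al + z.1 -> p1.2 + z.2 < c.2 + k.2).
Proof.
move=> vC vK w0 Cp1 Cp2 p11 p21 low laE Kt tmin tb tz zb zlow [[k0 Kk0 k0z] zb'].
split.
  have k0lt := zb' _ Kk0 k0z.
  have [c Cc [c1 cE]] := between_x vC Cp1 Cp2 (x := al + (z.1 - t.1)) ltac:(lra) ltac:(lra).
  have cE' : c.2 - p1.2 = la * (z.1 - t.1).
    apply: (mulfI (lt0r_neq0 w0)).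
    by move: cE; rewrite p11 p21 -laE => cE; nra.
  have s1 : minkowski_sum C K (al + z.1, c.2 + t.2).
    by exists c => //; exists t => //; apply: plane_eq => //=; lra.
  have s2 : minkowski_sum C K (al + z.1, p1.2 + k0.2).
    by exists p1 => //; exists k0 => //; apply: plane_eq => //=; lra.
  have vCK := convex_minkowski vC vK.
  have -> : p1 + z = (al + z.1, p1.2 + z.2) by apply: plane_eq => //=; lra.
  by apply: (between_y vCK s1 s2); lra.
move=> c k Cc Kk cal ckE.
have Hc : la * (c.1 - p1.1) <= c.2 - p1.2.
  apply: (chord_extension_le vC Cc Cp2); rewrite ?p11 ?p21 ?ltrDl//.
  by rewrite addrAC subrr add0r.
have [k' Kk' [k'1 k'E]] := between_x vK Kt Kk tz (x := z.1) ltac:(lra).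
have zk' := zb' _ Kk' k'1.
have kmin := tmin _ Kk.
(* The function compared is least at [t], hence it increases along the chord
   from [t] to [k], which passes through [k']. *)
have Hk : k'.2 - la * k'.1 <= k.2 - la * k.1.
  have [tk|tk] := eqVneq k.1 t.1.
    have tz' : t.1 = z.1 by lra.
    by have := zb' _ Kt tz'; move: zlow; rewrite -tz'; lra.
  have tk' : 0 < k.1 - t.1 by rewrite subr_gt0 lt_neqAle eq_sym tk /=; lra.
  rewrite -(ler_pM2l tk') k'1.
  suff : (z.1 - t.1) * (k.2 - t.2) <= (k.1 - t.1) * (k.2 - t.2) - (k.1 - t.1) * la * (k.1 - z.1) by nra.
  have : 0 <= (k.1 - z.1) * ((k.2 - la * k.1) - (t.2 - la * t.1)) by apply: mulr_ge0; lra.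
  by nra.
rewrite p11 k'1 in Hc Hk *.
have : la * (c.1 - al) + la * (k.1 - z.1) = 0.
  by rewrite -mulrDr (_ : _ + _ = 0) ?mulr0//; lra.
lra.
Qed.

(** The reflections in the axes, for [s1] and [s2] equal to 1 or -1.  They turn one
    of the four gaps into any other. *)
Definition refl (s1 s2 : R) p : plane R := (s1 * p.1, s2 * p.2).

Lemma convex_refl (s1 s2 : R) A : convex A ->
  convex (refl s1 s2 @^-1` A).
Proof.
move=> vA; apply/convex_setP => p q t Ap Aq t0 t1 /=.
by apply: (convex_at vA Ap Aq t0 t1); rewrite /= /GRing.scale /=; ring.
Qed.

Lemma minkowski_refl (s1 s2 : R) C K z : s1 * s1 = 1 -> s2 * s2 = 1 ->
  minkowski_sum (refl s1 s2 @^-1` C) (refl s1 s2 @^-1` K) (refl s1 s2 z) ->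
  minkowski_sum C K z.
Proof.
move=> h1 h2 [x Cx [y Ky]] /(congr1 (refl s1 s2)) E.
exists (refl s1 s2 x) => //; exists (refl s1 s2 y) => //.
have -> : z = refl s1 s2 (refl s1 s2 z).
  by apply: plane_eq; rewrite /= mulrA ?h1 ?h2 mul1r.
by rewrite -E; apply: plane_eq => /=; ring.
Qed.

Lemma reflK (s1 s2 : R) p : s1 * s1 = 1 -> s2 * s2 = 1 -> refl s1 s2 (refl s1 s2 p) = p.
Proof. by move=> h1 h2; apply: plane_eq; rewrite /= mulrA ?h1 ?h2 mul1r. Qed.

Lemma gap_below_left C K (al w a la : R) p1 p2 t z :
  convex C -> convex K ->
  0 < w -> C p1 -> C p2 -> p1.1 = al -> p2.1 = al + w ->
  (forall c, C c -> c.1 = al + w -> p2.2 <= c.2) ->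
  la * w = p2.2 - p1.2 ->
  K t -> (forall k, K k -> t.2 - la * t.1 <= k.2 - la * k.1) ->
  t.1 <= a + w ->
  z.1 <= t.1 -> a <= z.1 -> t.2 - la * t.1 <= z.2 - la * z.1 -> below K z ->
  minkowski_sum C K (p2 + z) /\
  (forall c k, C c -> K k -> al + w <= c.1 -> c.1 + k.1 = al + w + z.1 -> p2.2 + z.2 < c.2 + k.2).
Proof.
move=> vC vK w0 Cp1 Cp2 p11 p21 low laE Kt tmin ta zt az zlow [[k0 Kk0 k0z] zb].
pose r := refl (-1) 1.
have h1 : (-1) * (-1) = 1 :> R by ring.
have h2 : 1 * 1 = 1 :> R by ring.
have rK p : r (r p) = p by exact: reflK.
have [] := @gap_below_right (r @^-1` C) (r @^-1` K) (- (al + w)) w (- a) (- la) (r p2) (r p1) (r t) (r z);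
  rewrite /preimage /= ?rK//; try exact: convex_refl; try (by rewrite /r /=; lra).
- by move=> c Cc c1; have := low _ Cc; rewrite /r /= => /(_ ltac:(lra)); lra.
- by move=> k Kk; have := tmin _ Kk; rewrite /r /=; lra.
- split; first by exists (r k0); [rewrite /= rK|rewrite /r /= k0z].
  by move=> k Kk k1; have := zb _ Kk; rewrite /r /= in k1 *; rewrite !mul1r; apply; lra.
move=> S B; split.
  apply: (minkowski_refl h1 h2).
  by rewrite -/r (_ : r (p2 + z) = r p2 + r z) //; apply: plane_eq => /=; ring.
move=> c k Cc Kk cal ck; have := B (r c) (r k); rewrite !rK => /(_ Cc Kk).
by rewrite /r /= => /(_ ltac:(lra) ltac:(lra)); lra.
Qed.

Lemma gap_above_right C K (al w b la : R) p1 p2 t z :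
  convex C -> convex K ->
  0 < w -> C p1 -> C p2 -> p1.1 = al -> p2.1 = al + w ->
  (forall c, C c -> c.1 = al -> c.2 <= p1.2) ->
  la * w = p2.2 - p1.2 ->
  K t -> (forall k, K k -> k.2 - la * k.1 <= t.2 - la * t.1) ->
  b - w <= t.1 ->
  t.1 <= z.1 -> z.1 <= b -> z.2 - la * z.1 <= t.2 - la * t.1 -> above K z ->
  minkowski_sum C K (p1 + z) /\
  (forall c k, C c -> K k -> c.1 <= al -> c.1 + k.1 = al + z.1 -> c.2 + k.2 < p1.2 + z.2).
Proof.
move=> vC vK w0 Cp1 Cp2 p11 p21 low laE Kt tmin ta zt az zlow [[k0 Kk0 k0z] zb].
pose r := refl 1 (-1).
have h1 : (-1) * (-1) = 1 :> R by ring.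
have h2 : 1 * 1 = 1 :> R by ring.
have rK p : r (r p) = p by exact: reflK.
have [] := @gap_below_right (r @^-1` C) (r @^-1` K) al w b (- la) (r p1) (r p2) (r t) (r z);
  rewrite /preimage /= ?rK//; try exact: convex_refl; try (by rewrite /r /=; lra).
- by move=> c Cc c1; have := low _ Cc; rewrite /r /= => /(_ ltac:(lra)); lra.
- by move=> k Kk; have := tmin _ Kk; rewrite /r /=; lra.
- split; first by exists (r k0); [rewrite /= rK|rewrite /r /= k0z].
  by move=> k Kk k1; have := zb _ Kk; rewrite /r /= in k1 *; move=> /(_ ltac:(lra)); lra.
move=> S B; split.
  apply: (minkowski_refl h2 h1).
  by rewrite -/r (_ : r (p1 + z) = r p1 + r z) //; apply: plane_eq => /=; ring.
move=> c k Cc Kk cal ck; have := B (r c) (r k); rewrite !rK => /(_ Cc Kk).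
by rewrite /r /= => /(_ ltac:(lra) ltac:(lra)); lra.
Qed.

Lemma gap_above_left C K (al w a la : R) p1 p2 t z :
  convex C -> convex K ->
  0 < w -> C p1 -> C p2 -> p1.1 = al -> p2.1 = al + w ->
  (forall c, C c -> c.1 = al + w -> c.2 <= p2.2) ->
  la * w = p2.2 - p1.2 ->
  K t -> (forall k, K k -> k.2 - la * k.1 <= t.2 - la * t.1) ->
  t.1 <= a + w ->
  z.1 <= t.1 -> a <= z.1 -> z.2 - la * z.1 <= t.2 - la * t.1 -> above K z ->
  minkowski_sum C K (p2 + z) /\
  (forall c k, C c -> K k -> al + w <= c.1 -> c.1 + k.1 = al + w + z.1 -> c.2 + k.2 < p2.2 + z.2).
Proof.
move=> vC vK w0 Cp1 Cp2 p11 p21 low laE Kt tmin ta zt az zlow [[k0 Kk0 k0z] zb].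
pose r := refl 1 (-1).
have h1 : (-1) * (-1) = 1 :> R by ring.
have h2 : 1 * 1 = 1 :> R by ring.
have rK p : r (r p) = p by exact: reflK.
have [] := @gap_below_left (r @^-1` C) (r @^-1` K) al w a (- la) (r p1) (r p2) (r t) (r z);
  rewrite /preimage /= ?rK//; try exact: convex_refl; try (by rewrite /r /=; lra).
- by move=> c Cc c1; have := low _ Cc; rewrite /r /= => /(_ ltac:(lra)); lra.
- by move=> k Kk; have := tmin _ Kk; rewrite /r /=; lra.
- split; first by exists (r k0); [rewrite /= rK|rewrite /r /= k0z].
  by move=> k Kk k1; have := zb _ Kk; rewrite /r /= in k1 *; move=> /(_ ltac:(lra)); lra.
move=> S B; split.
  apply: (minkowski_refl h2 h1).
  by rewrite -/r (_ : r (p2 + z) = r p2 + r z) //; apply: plane_eq => /=; ring.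
move=> c k Cc Kk cal ck; have := B (r c) (r k); rewrite !rK => /(_ Cc Kk).
by rewrite /r /= => /(_ ltac:(lra) ltac:(lra)); lra.
Qed.

End Pieces.

(** * The area gained by cutting along a vertical strip *)

Section Step.
Context {R : realType}.
Implicit Types (p q t z : plane R) (A B C D K L X Y Z : set (plane R)).

Lemma measurable_halfplane (a b c : R) :
  measurable [set p : plane R | a * p.1 + b * p.2 <= c].
Proof. by apply: closed_plane_measurable; exact: closed_halfplane. Qed.

Lemma measurable_open_halfplane (a b c : R) :
  measurable [set p : plane R | a * p.1 + b * p.2 < c].
Proof.
have -> : [set p : plane R | a * p.1 + b * p.2 < c] =
   ~` [set p : plane R | - a * p.1 + - b * p.2 <= - c].
  apply/seteqP; split=> p /=; first by move=> ?; apply/negP; rewrite -ltNge; lra.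
  by move=> /negP; rewrite -ltNge; lra.
by apply: measurableC; exact: measurable_halfplane.
Qed.

Lemma compact_box (a b c d : R) : compact [set p : plane R | a <= p.1 <= b /\ c <= p.2 <= d].
Proof.
have -> : [set p : plane R | a <= p.1 <= b /\ c <= p.2 <= d] =
    `[a, b]%classic `*` `[c, d]%classic.
  by apply/seteqP; split=> p /=; rewrite /setX /= !in_itv.
by apply: compact_setX; exact: segment_compact.
Qed.

Definition rays (s : R) K : set (plane R) :=
  [set z | exists2 k, K k & k.1 = z.1 /\ s * k.2 <= s * z.2].

(** A union of countably many compact sets: the sums of [K] and of vertical
    segments of integral length. *)
Lemma measurable_rays (s : R) K : s * s = 1 -> compact K -> measurable (rays s K).
Proof.
move=> ss cK.
pose V (n : nat) := refl 1 s @` [set p : plane R | 0 <= p.1 <= 0 /\ 0 <= p.2 <= n%:R].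
have -> : rays s K = \bigcup_n minkowski_sum K (V n).
  apply/seteqP; split=> [z [k Kk [k1 k2]]|z [n _ [k Kk [_ [[q1 q2] [/= q10 /andP[q20 _]] <-] <-]]]].
    exists (Num.truncn (s * z.2 - s * k.2)).+1 => //.
    exists k => //; exists (refl 1 s (0, s * z.2 - s * k.2)).
      exists (0, s * z.2 - s * k.2) => //=; rewrite lexx; split => //.
      by rewrite subr_ge0 k2 /= ltW// truncnS_gt.
    apply: plane_eq => /=; first by rewrite k1; ring.
    by rewrite mulrBr !mulrA ss; ring.
  exists k => //=; have -> : q1 = 0 by apply/eqP; rewrite eq_le andbC.
  by split; [ring|rewrite mulrDr mulrA ss; lra].
apply: bigcupT_measurable => n; apply: compact_plane_measurable.
apply: compact_minkowski => //; apply: compact_image; first exact: compact_box.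
apply: plane_continuous2 => p; apply: cvgM; (try exact: cvg_cst).
  exact: fst_continuous.
exact: snd_continuous.
Qed.

Lemma area_disjointU3 X Y Z : measurable X -> measurable Y -> measurable Z ->
  X `&` Y = set0 -> X `&` Z = set0 -> Y `&` Z = set0 ->
  area (X `|` Y `|` Z) = (area X + area Y + area Z)%E.
Proof.
move=> mX mY mZ XY XZ YZ.
rewrite /area measureU//; last first.
- by rewrite setIUl XZ YZ setU0.
- exact: measurableU.
by rewrite measureU.
Qed.

Lemma le_areaU X Y : measurable X -> measurable Y ->
  (area (X `|` Y) <= area X + area Y)%E.
Proof. by move=> mX mY; exact: measureU2. Qed.

Lemma le_area_disjoint X Y D : measurable X -> measurable Y -> measurable D ->
  X `<=` D -> Y `<=` D -> X `&` Y = set0 -> (area X + area Y <= area D)%E.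
Proof.
move=> mX mY mD XD YD XY; rewrite /area -measureU//.
by apply: le_area => //; [exact: measurableU|rewrite subUset].
Qed.

Definition left_part C (x : R) : set (plane R) := C `&` [set p | p.1 <= x].
Definition right_part C (x : R) : set (plane R) := C `&` [set p | x <= p.1].

Lemma left_partE C (x : R) : left_part C x = C `&` [set p | 1 * p.1 + 0 * p.2 <= x].
Proof. by apply/seteqP; split=> p [? /= ?]; split => //=; lra. Qed.

Lemma right_partE C (x : R) : right_part C x = C `&` [set p | -1 * p.1 + 0 * p.2 <= - x].
Proof. by apply/seteqP; split=> p [? /= ?]; split => //=; lra. Qed.

Lemma measurable_left_part C (x : R) : measurable C -> measurable (left_part C x).
Proof. by move=> mC; rewrite left_partE; apply: measurableI => //; exact: measurable_halfplane. Qed.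

Lemma measurable_right_part C (x : R) : measurable C -> measurable (right_part C x).
Proof. by move=> mC; rewrite right_partE; apply: measurableI => //; exact: measurable_halfplane. Qed.

Lemma measurable_vline (c : R) : measurable [set p : plane R | p.1 = c].
Proof.
have -> : [set p : plane R | p.1 = c] =
    [set p : plane R | 1 * p.1 + 0 * p.2 <= c] `&` [set p : plane R | -1 * p.1 + 0 * p.2 <= - c].
  by apply/seteqP; split=> p /=; [move=> ?; split; lra|move=> [? ?]; lra].
by apply: measurableI; exact: measurable_halfplane.
Qed.

Lemma area_setD_vline X (c : R) : measurable X ->
  (area X <= area (X `\` [set p | p.1 = c]))%E.
Proof.
move=> mX; have mL := measurable_vline c; have mD := measurableD mX mL.
apply: (@le_trans _ _ (area ((X `\` [set p | p.1 = c]) `|` [set p | p.1 = c]))).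
  apply: le_area; [by []|exact: measurableU|].
  by move=> x Xx; have [Nx|Nx] := pselect ([set p : plane R | p.1 = c] x); [right|left; split].
by apply: (le_trans (le_areaU mD mL)); rewrite area_vline adde0.
Qed.

Definition open_strip (a b : R) : set (plane R) := [set p | a < p.1 /\ p.1 < b].

Lemma measurable_open_strip (a b : R) : measurable (open_strip a b).
Proof.
have -> : open_strip a b =
    [set p : plane R | -1 * p.1 + 0 * p.2 < - a] `&` [set p : plane R | 1 * p.1 + 0 * p.2 < b].
  by apply/seteqP; split=> p [/= ? ?]; split => /=; lra.
by apply: measurableI; exact: measurable_open_halfplane.
Qed.

(** The part of a trapezoid which is below a convex [K].  The vertical sides are
    left out, since pieces on both sides of a cut would share them. *)
Definition lower_gap K (a b la u : R) : set (plane R) :=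
  open_strip a b `&` [set p | la * p.1 + u <= p.2] `\` rays 1 K.

Definition upper_gap K (a b rho v : R) : set (plane R) :=
  open_strip a b `&` [set p | p.2 <= rho * p.1 + v] `\` rays (-1) K.

Lemma measurable_lower_gap K (a b la u : R) : compact K -> measurable (lower_gap K a b la u).
Proof.
move=> cK; apply: measurableD; last by apply: measurable_rays => //; ring.
apply: measurableI; first exact: measurable_open_strip.
have -> : [set p : plane R | la * p.1 + u <= p.2] = [set p | la * p.1 + (-1) * p.2 <= - u].
  by apply/seteqP; split=> p /= ?; lra.
exact: measurable_halfplane.
Qed.

Lemma measurable_upper_gap K (a b rho v : R) : compact K -> measurable (upper_gap K a b rho v).
Proof.
move=> cK; apply: measurableD; last by apply: measurable_rays => //; ring.
apply: measurableI; first exact: measurable_open_strip.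
have -> : [set p : plane R | p.2 <= rho * p.1 + v] = [set p | - rho * p.1 + 1 * p.2 <= v].
  by apply/seteqP; split=> p /= ?; lra.
exact: measurable_halfplane.
Qed.

(** A point both above and below points of [K] is in [K] by convexity; the two
    vertical lines that are not covered are null sets. *)
Lemma trapezoid_cover K (a b la u rho v : R) : compact K -> convex K ->
  (area (trapezoid a b la u rho v) <=
    area K + area (lower_gap K a b la u) + area (upper_gap K a b rho v))%E.
Proof.
move=> cK vK; have mT := measurable_trapezoid a b la u rho v.
apply: (le_trans (area_setD_vline a mT)).
have mTa := measurableD mT (measurable_vline a).
apply: (le_trans (area_setD_vline b mTa)).
have mK := compact_plane_measurable cK.
have mL := measurable_lower_gap a b la u cK.
have mU := measurable_upper_gap a b rho v cK.
have mKL := measurableU _ _ mK mL.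
apply: (@le_trans _ _ (area (K `|` lower_gap K a b la u `|` upper_gap K a b rho v))); last first.
  by apply: (le_trans (le_areaU mKL mU)); apply: leeD => //; exact: le_areaU.
apply: le_area; [exact: measurableD (measurable_vline b)|exact: measurableU|].
move=> z [[[az zb zl zu] /eqP za] /eqP zb'].
have Sz : open_strip a b z by split; rewrite lt_neqAle ?az ?zb andbT// eq_sym.
have [r1|r1] := pselect (rays 1 K z); last by left; right.
have [r2|r2] := pselect (rays (-1) K z); last by right.
left; left; case: r1 r2 => [k Kk [k1 k2]] [k' Kk' [k'1 k'2]].
have -> : z = (z.1, z.2) by case: (z).
have Hk : K (z.1, k.2) by rewrite -k1; case: (k) Kk.
have Hk' : K (z.1, k'.2) by rewrite -k'1; case: (k') Kk'.
by apply: (between_y vK Hk Hk'); lra.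
Qed.

Lemma le_area_split X (c : R) : measurable X ->
  (area X <= area (left_part X c) + area (right_part X c))%E.
Proof.
move=> mX.
have mL := measurable_left_part c mX; have mR := measurable_right_part c mX.
apply: le_trans (le_areaU mL mR); apply: le_area; [by []|exact: measurableU|].
by move=> x Xx; have [?|/ltW ?] := leP x.1 c; [left|right].
Qed.

Lemma adde_shuffle (k e1 e2 e3 e4 d1 d2 : \bar R) :
  (k + (e2 + e1) + (e4 + e3) + d1 + d2 = d1 + e1 + e3 + (d2 + e2 + e4) + k)%E.
Proof. by rewrite !addeA [LHS](ACl (6*3*5*7*2*4*1)). Qed.

(** The four gaps between [K] and the trapezoid, moved to the ends [p1], [p2] of
    the lower chord and [q1], [q2] of the upper one, are disjoint and avoid
    C1 + K and C2 + K: the two pieces on the same side of the cut are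
    strictly below and strictly above the same set, and pieces on different
    sides of the cut are separated by the vertical line at [al + b]. *)
Lemma strip_cut_area C K (al a b la rho : R) p1 p2 q1 q2 t t' :
  compact C -> convex C -> compact K -> convex K ->
  a < b ->
  C p1 -> C p2 -> C q1 -> C q2 ->
  p1.1 = al -> q1.1 = al -> p2.1 = al + (b - a) -> q2.1 = al + (b - a) ->
  (forall c, C c -> c.1 = al -> p1.2 <= c.2 <= q1.2) ->
  (forall c, C c -> c.1 = al + (b - a) -> p2.2 <= c.2 <= q2.2) ->
  la * (b - a) = p2.2 - p1.2 -> rho * (b - a) = q2.2 - q1.2 ->
  (forall k, K k -> a <= k.1 <= b) ->
  (exists2 k, K k & k.1 = a) -> (exists2 k, K k & k.1 = b) ->
  K t -> (forall k, K k -> t.2 - la * t.1 <= k.2 - la * k.1) ->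
  K t' -> (forall k, K k -> k.2 - rho * k.1 <= t'.2 - rho * t'.1) ->
  (area (trapezoid a b la (t.2 - la * t.1)%R rho (t'.2 - rho * t'.1)%R)
   + area (minkowski_sum (left_part C al) K)
   + area (minkowski_sum (right_part C (al + (b - a))%R) K)
   <= area (minkowski_sum C K) + area K)%E.
Proof.
move=> cC vC cK vK ab Cp1 Cp2 Cq1 Cq2 p11 q11 p21 q21 ext1 ext2 laE rhoE Kab [ka Ka kaE] [kb Kb kbE]
  Kt tmin Kt' tmax.
set w := b - a in p21 q21 ext2 laE rhoE *.
set u := t.2 - la * t.1; set v := t'.2 - rho * t'.1.
have w0 : 0 < w by rewrite subr_gt0.
have /andP[ta tb] := Kab _ Kt.
have /andP[t'a t'b] := Kab _ Kt'.
have fib z : a <= z.1 -> z.1 <= b -> exists2 k, K k & k.1 = z.1.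
  rewrite -{1}kaE -{1}kbE => az zb; have [k Kk [k1 _]] := between_x vK Ka Kb az zb.
  by exists k.
have lowerP z : lower_gap K a b la u z -> [/\ a < z.1, z.1 < b,
    t.2 - la * t.1 <= z.2 - la * z.1 & below K z].
  clear -fib => -[[[az zb] /= zl] nr]; split => //; first by rewrite /u in zl; lra.
  split; first by apply: fib; exact: ltW.
  move=> k Kk k1; rewrite ltNge; apply/negP => kz.
  by apply: nr; exists k => //; rewrite !mul1r.
have upperP z : upper_gap K a b rho v z -> [/\ a < z.1, z.1 < b,
    z.2 - rho * z.1 <= t'.2 - rho * t'.1 & above K z].
  clear -fib => -[[[az zb] /= zl] nr]; split => //; first by rewrite /v in zl; lra.
  split; first by apply: fib; exact: ltW.
  move=> k Kk k1; rewrite ltNge; apply/negP => kz.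
  by apply: nr; exists k => //; rewrite !mulN1r lerN2.
pose E1 := right_part (lower_gap K a b la u) t.1.
pose E2 := left_part (lower_gap K a b la u) t.1.
pose E3 := right_part (upper_gap K a b rho v) t'.1.
pose E4 := left_part (upper_gap K a b rho v) t'.1.
have mLo := measurable_lower_gap a b la u cK.
have mUp := measurable_upper_gap a b rho v cK.
have mE1 : measurable E1 by exact: measurable_right_part.
have mE2 : measurable E2 by exact: measurable_left_part.
have mE3 : measurable E3 by exact: measurable_right_part.
have mE4 : measurable E4 by exact: measurable_left_part.
have cover : (area (trapezoid a b la u rho v) <=
    area K + (area E2 + area E1) + (area E4 + area E3))%E.
  apply: (le_trans (trapezoid_cover a b la u rho v cK vK)).
  apply: leeD; last exact: le_area_split.
  by apply: leeD => //; exact: le_area_split.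
set D := minkowski_sum C K.
set D1 := minkowski_sum (left_part C al) K.
set D2 := minkowski_sum (right_part C (al + w)) K.
have mD : measurable D by apply: compact_plane_measurable; exact: compact_minkowski.
have mD1 : measurable D1.
  apply: compact_plane_measurable; apply: compact_minkowski => //.
  by rewrite left_partE; exact: compact_cut.
have mD2 : measurable D2.
  apply: compact_plane_measurable; apply: compact_minkowski => //.
  by rewrite right_partE; exact: compact_cut.
have lo1 c : C c -> c.1 = al -> p1.2 <= c.2 by move=> Cc c1; have /andP[] := ext1 _ Cc c1.
have up1 c : C c -> c.1 = al -> c.2 <= q1.2 by move=> Cc c1; have /andP[] := ext1 _ Cc c1.
have lo2 c : C c -> c.1 = al + w -> p2.2 <= c.2 by move=> Cc c1; have /andP[] := ext2 _ Cc c1.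
have up2 c : C c -> c.1 = al + w -> c.2 <= q2.2 by move=> Cc c1; have /andP[] := ext2 _ Cc c1.
have bw : b - w = a by rewrite /w; ring.
have aw : a + w = b by rewrite /w; ring.
have E1P z : E1 z -> [/\ a < z.1, z.1 < b & minkowski_sum C K (p1 + z) /\
  (forall c k, C c -> K k -> c.1 <= al -> c.1 + k.1 = al + z.1 -> p1.2 + z.2 < c.2 + k.2)].
  move=> [/lowerP[az zb zl zB] zt]; split => //.
  by apply: (gap_below_right (b := b) vC vK w0 Cp1 Cp2 p11 p21 lo1 laE Kt tmin _ zt (ltW zb) zl zB); rewrite bw.
have E2P z : E2 z -> [/\ a < z.1, z.1 < b & minkowski_sum C K (p2 + z) /\
  (forall c k, C c -> K k -> al + w <= c.1 -> c.1 + k.1 = al + w + z.1 -> p2.2 + z.2 < c.2 + k.2)].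
  move=> [/lowerP[az zb zl zB] zt]; split => //.
  by apply: (gap_below_left (a := a) vC vK w0 Cp1 Cp2 p11 p21 lo2 laE Kt tmin _ zt (ltW az) zl zB); rewrite aw.
have E3P z : E3 z -> [/\ a < z.1, z.1 < b & minkowski_sum C K (q1 + z) /\
  (forall c k, C c -> K k -> c.1 <= al -> c.1 + k.1 = al + z.1 -> c.2 + k.2 < q1.2 + z.2)].
  move=> [/upperP[az zb zl zB] zt]; split => //.
  by apply: (gap_above_right (b := b) vC vK w0 Cq1 Cq2 q11 q21 up1 rhoE Kt' tmax _ zt (ltW zb) zl zB); rewrite bw.
have E4P z : E4 z -> [/\ a < z.1, z.1 < b & minkowski_sum C K (q2 + z) /\
  (forall c k, C c -> K k -> al + w <= c.1 -> c.1 + k.1 = al + w + z.1 -> c.2 + k.2 < q2.2 + z.2)].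
  move=> [/upperP[az zb zl zB] zt]; split => //.
  by apply: (gap_above_left (a := a) vC vK w0 Cq1 Cq2 q11 q21 up2 rhoE Kt' tmax _ zt (ltW az) zl zB); rewrite aw.
(* [D1] and [D2] can meet only on the vertical line at [al + b],
   which is removed from [D2]. *)
pose G1 := D1 `|` translate p1 E1 `|` translate q1 E3.
pose D2' := D2 `\` [set p | p.1 = al + b].
pose G2 := D2' `|` translate p2 E2 `|` translate q2 E4.
have mT p X : measurable X -> measurable (translate p X) by exact: measurable_translate.
have mD2' : measurable D2' by apply: measurableD => //; exact: measurable_vline.
have mG1 : measurable G1 by apply: measurableU; [apply: measurableU|] => //; exact: mT.
have mG2 : measurable G2 by apply: measurableU; [apply: measurableU|] => //; exact: mT.
have aG1 : area G1 = (area D1 + area E1 + area E3)%E.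
  rewrite area_disjointU3 ?area_translate//; try exact: mT.
  - apply/seteqP; split=> // x [[c [Cc /= cal] [k Kk <-]] [z /E1P[_ _ [_ H]] E]].
    move: (H c k Cc Kk cal) (congr1 fst E) (congr1 snd E); clear -p11 => /=; lra.
  - apply/seteqP; split=> // x [[c [Cc /= cal] [k Kk <-]] [z /E3P[_ _ [_ H]] E]].
    move: (H c k Cc Kk cal) (congr1 fst E) (congr1 snd E); clear -q11 => /=; lra.
  - apply/seteqP; split=> // x [[z /E1P[az zb [_ H]] <-] [z' /E3P[_ _ [_ H']] E]].
    have [k Kk k1] := fib z (ltW az) (ltW zb).
    move: (congr1 fst E) (congr1 snd E) (H p1 k Cp1 Kk) (H' p1 k Cp1 Kk); clear -p11 q11 k1 => /=; lra.
have aG2 : area G2 = (area D2' + area E2 + area E4)%E.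
  rewrite area_disjointU3 ?area_translate//; try exact: mT.
  - apply/seteqP; split=> // x [[[c [Cc /= cal] [k Kk <-]] _] [z /E2P[_ _ [_ H]] E]].
    move: (H c k Cc Kk cal) (congr1 fst E) (congr1 snd E); clear -p21 => /=; lra.
  - apply/seteqP; split=> // x [[[c [Cc /= cal] [k Kk <-]] _] [z /E4P[_ _ [_ H]] E]].
    move: (H c k Cc Kk cal) (congr1 fst E) (congr1 snd E); clear -q21 => /=; lra.
  - apply/seteqP; split=> // x [[z /E2P[az zb [_ H]] <-] [z' /E4P[_ _ [_ H']] E]].
    have [k Kk k1] := fib z (ltW az) (ltW zb).
    move: (congr1 fst E) (congr1 snd E) (H p2 k Cp2 Kk) (H' p2 k Cp2 Kk); clear -p21 q21 k1 => /=; lra.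
have G1D : G1 `<=` D.
  move=> x [[[c [Cc _] [k Kk <-]]|[z /E1P[_ _ [H _]] <-]]|[z /E3P[_ _ [H _]] <-]] //.
  by exists c => //; exists k.
have G2D : G2 `<=` D.
  move=> x [[[[c [Cc _] [k Kk <-]] _]|[z /E2P[_ _ [H _]] <-]]|[z /E4P[_ _ [H _]] <-]] //.
  by exists c => //; exists k.
have G1x x : G1 x -> x.1 <= al + b.
  move=> [[[c [Cc /= cal] [k Kk <-]]|[z /E1P[_ zb _] <-]]|[z /E3P[_ zb _] <-]] /=.
  - by have /andP[_ kb'] := Kab _ Kk; exact: lerD.
  - by rewrite p11 lerD2l ltW.
  - by rewrite q11 lerD2l ltW.
have alb : al + b = al + w + a by rewrite -aw; ring.
have G2x x : G2 x -> al + b < x.1.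
  rewrite alb; move=> [[[[c [Cc /= cal] [k Kk <-]] nN]|[z /E2P[az _ _] <-]]|[z /E4P[az _ _] <-]] /=.
  - rewrite lt_neqAle; apply/andP; split.
      by apply/eqP => E; apply: nN; rewrite /= alb.
    by have /andP[ka' _] := Kab _ Kk; exact: lerD.
  - by rewrite p21 ltrD2l.
  - by rewrite q21 ltrD2l.
have G12 : G1 `&` G2 = set0.
  by apply/seteqP; split=> // x [/G1x H /G2x]; rewrite ltNge H.
have := le_area_disjoint mG1 mG2 mD G1D G2D G12.
rewrite aG1 aG2 => HD.
apply: (@le_trans _ _ ((area K + (area E2 + area E1) + (area E4 + area E3)) + area D1 + area D2')%E).
  by apply: leeD; [apply: leeD|exact: area_setD_vline].
apply: le_trans (leeD HD (lexx (area K))).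
by rewrite adde_shuffle.
Qed.

End Step.

(** * Cutting for a body and its reflection *)

Section Pair.
Context {R : realType}.
Implicit Types (p q t z k : plane R) (A B C D K L X Y Z : set (plane R)).

Definition oppset K : set (plane R) := [set - k | k in K].

Lemma oppsetE K : oppset K = affine_map (-1) 0 0 (-1) 0 0 @` K.
Proof.
by apply: eq_imagel => p _; apply: plane_eq => /=; ring.
Qed.

Lemma compact_opp K : compact K -> compact (oppset K).
Proof.
by move=> cK; rewrite oppsetE; apply: compact_image => //; exact: affine_map_continuous.
Qed.

Lemma convex_opp K : convex K -> convex (oppset K).
Proof. by move=> vK; rewrite oppsetE; exact: affine_map_convex. Qed.

Lemma area_opp K : measurable K -> area (oppset K) = area K.
Proof.
move=> mK; rewrite oppsetE area_affine_map//.
by rewrite mul0r subr0 mulrNN mulr1 normr1 mul1e.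
Qed.

(** The slopes of the lines from the point (0, d) to points of [B] on its right are
    at most the slopes to points on its left, by convexity and the choice of
    [d]; the supremum of the former is the slope of a supporting line. *)
Lemma fiber_support B (d : R) : convex B ->
  (forall z, B z -> z.1 = 0 -> z.2 <= d) ->
  (exists2 z, B z & 0 < z.1) -> (exists2 z, B z & z.1 < 0) ->
  exists m : R, forall z, B z -> z.2 - m * z.1 <= d.
Proof.
move=> vB d_max [zr Br zr0] [zl Bl zl0].
have slopes z z' : B z -> B z' -> 0 < z.1 -> z'.1 < 0 ->
    (z.2 - d) / z.1 <= (z'.2 - d) / z'.1.
  move=> Bz Bz' z0 z'0; have [y By [y1 yE]] := between_x vB Bz' Bz (ltW z'0) (ltW z0).
  have yd := d_max _ By y1.
  rewrite ler_pdivrMr// mulrAC ler_ndivlMr//.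
  have : (z.1 - z'.1) * (y.2 - z'.2) <= (z.1 - z'.1) * (d - z'.2) by apply: ler_wpM2l; lra.
  by rewrite -yE; lra.
pose S := [set r | exists2 z, B z & 0 < z.1 /\ r = (z.2 - d) / z.1].
have hS : has_sup S.
  split; first by exists ((zr.2 - d) / zr.1); exists zr.
  by exists ((zl.2 - d) / zl.1) => _ [z Bz [z0 ->]]; exact: slopes.
exists (sup S) => z Bz; have [z0|z0|z0] := ltgtP z.1 0; last first.
- by rewrite z0 mulr0 subr0; exact: d_max.
- have : (z.2 - d) / z.1 <= sup S by apply: sup_upper_bound => //; exists z.
  by rewrite ler_pdivrMr//; lra.
- have : sup S <= (z.2 - d) / z.1.
    by apply: ge_sup; [case: hS|move=> _ [z' Bz' [z'0 ->]]; exact: slopes].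
  by rewrite ler_ndivlMr//; lra.
Qed.

(** A longest vertical chord of [K] is a highest point of K - K on the second
    axis; a supporting line of K - K there gives parallel supporting lines of
    [K] at the ends of the chord. *)
Lemma longest_chord K (a b : R) : compact K -> convex K -> a < b ->
  (exists2 k, K k & k.1 = a) -> (exists2 k, K k & k.1 = b) ->
  exists k1 k2, exists m : R, [/\ K k1, K k2, k1.1 = k2.1 &
    forall k, K k -> k1.2 - m * k1.1 <= k.2 - m * k.1 /\ k.2 - m * k.1 <= k2.2 - m * k2.1].
Proof.
move=> cK vK ab [ka Ka kaE] [kb Kb kbE].
pose B := minkowski_sum K (oppset K).
have vB : convex B by apply: convex_minkowski => //; exact: convex_opp.
have cB : compact B by apply: compact_minkowski => //; exact: compact_opp.
have BK k k' : K k -> K k' -> B (k - k') by move=> Kk Kk'; exists k => //; exists (- k') => //; exists k'.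
have n0 : (B `&` [set p | p.1 = 0]) !=set0.
  by exists (ka - ka); split; [exact: BK|rewrite /= subrr].
have [z [Bz /= z1] zmax] := compact_argmax n0 (compact_fiber (x := 0) cB) (@snd_continuous R).
have [m Hm] : exists m : R, forall y, B y -> y.2 - m * y.1 <= z.2.
  apply: fiber_support => //.
  - by move=> y By y1; apply: zmax.
  - by exists (kb - ka); [exact: BK|rewrite /= kaE kbE subr_gt0].
  - by exists (ka - kb); [exact: BK|rewrite /= kaE kbE subr_lt0].
case: Bz z1 zmax Hm => k2 Kk2 [_ [k1 Kk1 <-] <-] /= z1 zmax Hm.
exists k1, k2, m; split => //; first by lra.
have k12 : k1.1 = k2.1 by lra.
move=> k Kk; have /= := Hm _ (BK _ _ Kk Kk1); have /= := Hm _ (BK _ _ Kk2 Kk).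
by rewrite k12; split; lra.
Qed.

Lemma lee_combine (w t1 t2 : R) (a1 a2 a3 a4 d d' k k' : \bar R) :
  (t1%:E + a1 + a2 <= d + k)%E -> (t2%:E + a3 + a4 <= d' + k')%E -> w <= t1 + t2 ->
  (w%:E + (a1 + a2) + (a3 + a4) <= d + d' + (k + k'))%E.
Proof.
move=> H1 H2 wt; have wt' : (w%:E <= t1%:E + t2%:E)%E by rewrite -EFinD lee_fin.
apply: (@le_trans _ _ ((t1%:E + t2%:E) + (a1 + a2) + (a3 + a4))%E).
  by do 2!apply: leeD => //.
have -> : ((t1%:E + t2%:E) + (a1 + a2) + (a3 + a4) = (t1%:E + a1 + a2) + (t2%:E + a3 + a4))%E.
  by rewrite !addeA [LHS](ACl (1*3*4*2*5*6)).
have -> : (d + d' + (k + k') = (d + k) + (d' + k'))%E.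
  by rewrite !addeA [LHS](ACl (1*3*2*4)).
exact: leeD.
Qed.

(** The areas of the trapezoids of [K] and of its reflection add up to the width
    b - a times the sum of the variations over [K] of the two linear forms
    vanishing on the slanted directions.  On a vertical chord each form varies by the
    length of the chord. *)
Lemma strip_cut_reflected C K (al a b : R) k1 k2 :
  compact C -> convex C -> compact K -> convex K ->
  a < b ->
  (forall k, K k -> a <= k.1 <= b) ->
  (exists2 k, K k & k.1 = a) -> (exists2 k, K k & k.1 = b) ->
  K k1 -> K k2 -> k1.1 = k2.1 ->
  (exists2 c, C c & c.1 <= al) -> (exists2 c, C c & al + (b - a) <= c.1) ->
  ((2 * ((b - a) * (k2.2 - k1.2)))%:E
   + (area (minkowski_sum (left_part C al) K) + area (minkowski_sum (right_part C (al + (b - a)%R)%R) K))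
   + (area (minkowski_sum (left_part C al) (oppset K)) + area (minkowski_sum (right_part C (al + (b - a)%R)%R) (oppset K)))
   <= area (minkowski_sum C K) + area (minkowski_sum C (oppset K)) + (area K + area K))%E.
Proof.
move=> cC vC cK vK ab Kab Ka Kb Kk1 Kk2 k12 [cl Ccl cl1] [cr Ccr cr1].
have w0 : 0 < b - a by rewrite subr_gt0.
have fibC x : al <= x -> x <= al + (b - a) -> (C `&` [set p | p.1 = x]) !=set0.
  move=> x1 x2; have [z Cz [z1 _]] := between_x vC Ccl Ccr (x := x) ltac:(lra) ltac:(lra).
  by exists z.
have ext x : al <= x -> x <= al + (b - a) -> exists p q,
    [/\ C p, C q, p.1 = x, q.1 = x & forall c, C c -> c.1 = x -> p.2 <= c.2 <= q.2].
  move=> x1 x2; have n0 := fibC x x1 x2.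
  have [p [Cp p1] pm] := compact_argmin n0 (compact_fiber (x := x) cC) (@snd_continuous R).
  have [q [Cq q1] qm] := compact_argmax n0 (compact_fiber (x := x) cC) (@snd_continuous R).
  by exists p, q; split => // c Cc c1; apply/andP; split; [exact: pm|exact: qm].
have [p1 [q1 [Cp1 Cq1 p11 q11 ext1]]] := ext al (lexx _) ltac:(lra).
have [p2 [q2 [Cp2 Cq2 p21 q21 ext2]]] := ext (al + (b - a)) ltac:(lra) (lexx _).
pose la := (p2.2 - p1.2) / (b - a); pose rho := (q2.2 - q1.2) / (b - a).
have laE : la * (b - a) = p2.2 - p1.2 by rewrite /la mulfVK// gt_eqF.
have rhoE : rho * (b - a) = q2.2 - q1.2 by rewrite /rho mulfVK// gt_eqF.
have K0 : K !=set0 by exists k1.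
have cf (m : R) : continuous (fun p : plane R => (- m) * p.1 + 1 * p.2 + 0) by exact: affine_continuous.
have [t Kt tm] := compact_argmin K0 cK (cf la).
have [s Ks sm] := compact_argmax K0 cK (cf la).
have [s' Ks' s'm] := compact_argmin K0 cK (cf rho).
have [t' Kt' t'm] := compact_argmax K0 cK (cf rho).
have Ko z : oppset K z <-> K (- z).
  by split=> [[k Kk <-]|Kz]; [rewrite opprK|exists (- z); rewrite ?opprK].
have := @strip_cut_area R C K al a b la rho p1 p2 q1 q2 t t' cC vC cK vK ab Cp1 Cp2 Cq1 Cq2
  p11 q11 p21 q21 ext1 ext2 laE rhoE Kab Ka Kb Kt _ Kt' _.
move=> /(_ (fun k Kk => ltac:(have := tm k Kk; rewrite /=; lra))
           (fun k Kk => ltac:(have := t'm k Kk; rewrite /=; lra))) S1.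
have ab' : - b < - a by rewrite ltrN2.
have wE : - a - - b = b - a by ring.
have := @strip_cut_area R C (oppset K) al (- b) (- a) la rho p1 p2 q1 q2 (- s) (- s')
  cC vC (compact_opp cK) (convex_opp vK) ab' Cp1 Cp2 Cq1 Cq2 p11 q11.
rewrite wE => /(_ p21 q21 ext1 ext2 laE rhoE).
move=> /(_ (fun k (Kk : oppset K k) => ltac:(have := Kab _ (proj1 (Ko k) Kk); rewrite /=; lra))).
case: Ka Kb => [ka Kka kaE] [kb Kkb kbE].
have Kob : exists2 k, oppset K k & k.1 = - b by exists (- kb); [exists kb|rewrite /= kbE].
have Koa : exists2 k, oppset K k & k.1 = - a by exists (- ka); [exists ka|rewrite /= kaE].
have Kos : oppset K (- s) by exists s.
have Kos' : oppset K (- s') by exists s'.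
move=> /(_ Kob Koa Kos
  (fun k (Kk : oppset K k) => ltac:(have := sm _ (proj1 (Ko k) Kk); rewrite /=; lra)) Kos'
  (fun k (Kk : oppset K k) => ltac:(have := s'm _ (proj1 (Ko k) Kk); rewrite /=; lra))) S2.
have tr1 : area (trapezoid a b la (t.2 - la * t.1) rho (t'.2 - rho * t'.1)) =
   ((b - a) * ((rho - la) * (a + b) / 2 + (t'.2 - rho * t'.1 - (t.2 - la * t.1))))%:E.
  apply: area_trapezoid => //.
    have := tm _ Kka; have := t'm _ Kka; rewrite kaE /=; lra.
  have := tm _ Kkb; have := t'm _ Kkb; rewrite kbE /=; lra.
have tr2 : area (trapezoid (- b) (- a) la ((- s).2 - la * (- s).1) rho ((- s').2 - rho * (- s').1)) =
   ((b - a) * ((rho - la) * (- b - a) / 2 + ((- s').2 - rho * (- s').1 - ((- s).2 - la * (- s).1))))%:E.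
  rewrite area_trapezoid ?wE//.
    have := sm _ Kkb; have := s'm _ Kkb; rewrite kbE /=; lra.
  have := sm _ Kka; have := s'm _ Kka; rewrite kaE /=; lra.
rewrite tr1 in S1; rewrite tr2 in S2.
rewrite (area_opp (compact_plane_measurable cK)) in S2.
apply: lee_combine S1 S2 _.
have H1 := sm _ Kk2; have H2 := tm _ Kk1; have H3 := t'm _ Kk2; have H4 := s'm _ Kk1.
have -> : (b - a) * ((rho - la) * (a + b) / 2 + (t'.2 - rho * t'.1 - (t.2 - la * t.1))) +
  (b - a) * ((rho - la) * (- b - a) / 2 + ((- s').2 - rho * (- s').1 - ((- s).2 - la * (- s).1))) =
  (b - a) * ((t'.2 - rho * t'.1) - (s'.2 - rho * s'.1) + ((s.2 - la * s.1) - (t.2 - la * t.1))).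
  by rewrite /=; field.
rewrite mulrCA ler_pM2l//; move: H1 H2 H3 H4; rewrite -k12 /=; lra.
Qed.

End Pair.

(** * Cutting in an arbitrary direction *)

Section Transfer.
Context {R : realType}.
Implicit Types (p q t u v z k : plane R) (A B C D K L Q X Y Z : set (plane R)).

Notation lin a b c d := (affine_map a b c d 0 0).

Lemma affine_minkowski (a b c d e f : R) A B :
  affine_map a b c d e f @` minkowski_sum A B =
  minkowski_sum (lin a b c d @` A) (affine_map a b c d e f @` B).
Proof.
have E p q : affine_map a b c d e f (p + q) = lin a b c d p + affine_map a b c d e f q.
  by apply: plane_eq => /=; ring.
apply/seteqP; split=> [_ [_ [p Ap [q Bq <-]] <-]|_ [_ [p Ap <-] [_ [q Bq <-] <-]]].
  by rewrite E; exists (lin a b c d p); [exists p|exists (affine_map a b c d e f q) => //; exists q].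
by rewrite -E; exists (p + q) => //; exists p => //; exists q.
Qed.

Lemma affine_opp (a b c d e f : R) A :
  oppset (affine_map a b c d e f @` A) = affine_map a b c d (- e) (- f) @` oppset A.
Proof.
by rewrite /oppset !image_comp; apply: eq_imagel => p _; apply: plane_eq => /=; ring.
Qed.

Lemma lin_segment (a b c d : R) p u :
  lin a b c d @` segment p u = segment (lin a b c d p) (lin a b c d u).
Proof.
rewrite image_comp; apply: eq_imagel => s _.
by apply: plane_eq; rewrite /= /GRing.scale /=; ring.
Qed.

Lemma lin_parallelogram (a b c d : R) p u v :
  lin a b c d @` parallelogram p u v =
  parallelogram (lin a b c d p) (lin a b c d u) (lin a b c d v).
Proof.
have E (s t : R) : lin a b c d (p + s *: u + t *: v) =
    lin a b c d p + s *: lin a b c d u + t *: lin a b c d v.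
  by apply: plane_eq; rewrite /= /GRing.scale /=; ring.
apply/seteqP; split=> [_ [_ [s s01 [t t01 <-]] <-]|_ [s s01 [t t01 <-]]].
  by rewrite E; exists s => //; exists t.
by rewrite -E; exists (p + s *: u + t *: v) => //; exists s => //; exists t.
Qed.

Lemma circumscribed_lin (a b c d : R) K Q : a * d - b * c != 0 ->
  circumscribed_parallelogram K Q ->
  circumscribed_parallelogram (lin a b c d @` K) (lin a b c d @` Q).
Proof.
move=> D [p [u [v [uv -> KQ [S1 S2] [S3 S4]]]]].
pose f := lin a b c d.
have side p' u' : segment p' u' `&` K !=set0 -> segment (f p') (f u') `&` (f @` K) !=set0.
  move=> [z [Sz Kz]]; exists (f z); split; last by exists z.
  by rewrite -lin_segment; exists z.
have fD p' q' : f p' + f q' = f (p' + q') by apply: plane_eq => /=; ring.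
exists (f p), (f u), (f v); split.
- have -> : (f u).1 * (f v).2 - (f u).2 * (f v).1 = (a * d - b * c) * (u.1 * v.2 - u.2 * v.1).
    by rewrite /=; ring.
  by rewrite mulf_neq0.
- exact: lin_parallelogram.
- exact: image_subset.
- by rewrite !fD; split; exact: side.
- by rewrite !fD; split; exact: side.
Qed.

Lemma circumscribed_trapezoid K (a b m u v : R) : a < b -> u < v ->
  (forall k, K k -> a <= k.1 <= b) ->
  (exists2 k, K k & k.1 = a) -> (exists2 k, K k & k.1 = b) ->
  (forall k, K k -> u <= k.2 - m * k.1 /\ k.2 - m * k.1 <= v) ->
  (exists2 k, K k & k.2 - m * k.1 = u) -> (exists2 k, K k & k.2 - m * k.1 = v) ->
  circumscribed_parallelogram K (trapezoid a b m u m v).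
Proof.
move=> ab uv Kab [ka Ka kaE] [kb Kb kbE] Kuv [ku Ku kuE] [kv Kv kvE].
have ba : 0 < b - a by lra.
have vu : 0 < v - u by lra.
pose S k := (k.2 - m * k.1 - u) / (v - u); pose T k := (k.1 - a) / (b - a).
have S01 k : K k -> 0 <= S k <= 1.
  move=> /Kuv[k1 k2]; rewrite divr_ge0 ?ler_pdivrMr//; lra.
have T01 k : K k -> 0 <= T k <= 1.
  move=> /Kab/andP[k1 k2]; rewrite divr_ge0 ?ler_pdivrMr//; lra.
have SE k : S k * (v - u) = k.2 - m * k.1 - u by rewrite /S mulfVK// gt_eqF.
have TE k : T k * (b - a) = k.1 - a by rewrite /T mulfVK// gt_eqF.
exists (a, m * a + u), (0, v - u), (b - a, m * (b - a)); split => /=.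
- by rewrite mul0r sub0r oppr_eq0 mulf_neq0 ?gt_eqF.
- apply/seteqP; split=> [z [az zb zu zv]|_ [s s01 [t t01 <-]]].
    exists (S z); first by rewrite /= in_itv /= divr_ge0 ?ler_pdivrMr//; lra.
    exists (T z); first by rewrite /= in_itv /= divr_ge0 ?ler_pdivrMr//; lra.
    apply: plane_eq => /=; rewrite /GRing.scale /=.
      by rewrite TE; ring.
    by rewrite SE mulrCA TE; ring.
  move: s01 t01; rewrite /= !in_itv /= => /andP[s0 s1] /andP[t0 t1].
  by split; rewrite /= /GRing.scale /=; nra.
- move=> k Kk; have /andP[? ?] := Kab _ Kk; have [? ?] := Kuv _ Kk.
  by split; lra.
- split.
    exists ka; split => //; exists (S ka); first by rewrite /= in_itv /= S01.
    by apply: plane_eq; rewrite /= /GRing.scale /= ?SE kaE; ring.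
  exists kb; split => //; exists (S kb); first by rewrite /= in_itv /= S01.
  by apply: plane_eq; rewrite /= /GRing.scale /= ?SE kbE; ring.
- split.
    exists ku; split => //; exists (T ku); first by rewrite /= in_itv /= T01.
    by apply: plane_eq; rewrite /= /GRing.scale /= ?(mulrCA (T _)) TE -?kuE; ring.
  exists kv; split => //; exists (T kv); first by rewrite /= in_itv /= T01.
  by apply: plane_eq; rewrite /= /GRing.scale /= ?(mulrCA (T _)) TE -?kvE; ring.
Qed.

Lemma interior_shift K z v : K° z -> exists2 r : R, 0 < r & K (z + r *: v) /\ K (z - r *: v).
Proof.
move=> /nbhs_ballP[e /= e0 eK].
pose M := `|v.1| + `|v.2| + 1.
have M0 : 0 < M by rewrite /M; have := normr_ge0 v.1; have := normr_ge0 v.2; lra.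
have r0 : 0 < e / M by rewrite divr_gt0.
exists (e / M) => //.
have small (x : R) : `|x| < M -> `|e / M * x| < e.
  by move=> xM; rewrite normrM gtr0_norm// -[X in _ < X](@divfK _ M) ?gt_eqF// ltr_pM2l.
have v1 : `|v.1| < M by rewrite /M; have := normr_ge0 v.2; lra.
have v2 : `|v.2| < M by rewrite /M; have := normr_ge0 v.1; lra.
split; apply: eK; split; rewrite /ball /= /GRing.scale /=.
- by rewrite opprD addrA subrr sub0r normrN; exact: small.
- by rewrite opprD addrA subrr sub0r normrN; exact: small.
- by rewrite opprB addrC subrK; exact: small.
- by rewrite opprB addrC subrK; exact: small.
Qed.

Definition half_le u C (x : R) : set (plane R) := C `&` [set c | dot u c <= x].
Definition half_ge u C (x : R) : set (plane R) := C `&` [set c | x <= dot u c].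

Lemma compact_half_le u C (x : R) : compact C -> compact (half_le u C x).
Proof. exact: compact_cut. Qed.

Lemma half_geE u C (x : R) : half_ge u C x = half_le (- u) C (- x).
Proof. by apply/seteqP; split=> p [Cp /= H]; split => //=; move: H; rewrite /dot /=; lra. Qed.

Lemma compact_half_ge u C (x : R) : compact C -> compact (half_ge u C x).
Proof. by rewrite half_geE; exact: compact_half_le. Qed.

(** A linear map of determinant one carries the form [dot u] to the first
    coordinate.  The longest chord in the direction of the lines then has, times
    the width, the area of a circumscribed parallelogram. *)
Lemma halfplane_cut_area K Q C u (al : R) km kM :
  convex_domain K -> min_area_circumscribed_parallelogram K Q ->
  compact C -> convex C -> u != 0 ->
  K km -> K kM -> (forall k, K k -> dot u km <= dot u k <= dot u kM) ->
  (exists2 c, C c & dot u c <= al) ->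
  (exists2 c, C c & al + (dot u kM - dot u km) <= dot u c) ->
  ((area Q + area Q)
   + (area (minkowski_sum (half_le u C al) K) + area (minkowski_sum (half_ge u C (al + (dot u kM - dot u km))%R) K))
   + (area (minkowski_sum (half_le u C al) (oppset K)) + area (minkowski_sum (half_ge u C (al + (dot u kM - dot u km))%R) (oppset K)))
   <= area (minkowski_sum C K) + area (minkowski_sum C (oppset K)) + (area K + area K))%E.
Proof.
move=> [cK vK [z0 z0K]] [_ Qmin] cC vC u0 Kkm KkM Kw [cl Ccl cl1] [cr Ccr cr1].
set C1 := half_le u C al; set C2 := half_ge u C _.
pose n := dot u u.
have n0 : 0 < n by exact: dot_self_gt0.
have nn0 : n != 0 by rewrite gt_eqF.
(* [S] is the inverse of [T]. *)
pose T := lin u.1 u.2 (- u.2 / n) (u.1 / n).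
pose S := lin (u.1 / n) (- u.2) (u.2 / n) u.1.
have detT : u.1 * (u.1 / n) - u.2 * (- u.2 / n) = 1.
  by rewrite mulNr mulrN opprK !mulrA -mulrDl -/n divff.
have detS : u.1 / n * u.1 - - u.2 * (u.2 / n) = 1.
  by rewrite -[RHS]detT; ring.
have ST p : S (T p) = p.
  have E : u.1 * u.1 = n - u.2 * u.2 by rewrite /n /dot; ring.
  apply: plane_eq; rewrite /S /T /=; apply: (mulfI nn0).
    transitivity ((u.1 * u.1 + u.2 * u.2) * p.1); first by field.
    by rewrite E; ring.
  transitivity ((u.1 * u.1 + u.2 * u.2) * p.2); first by field.
  by rewrite E; ring.
have T1 p : (T p).1 = dot u p by rewrite /T /= addr0.
have mT A : measurable A -> area (T @` A) = area A.
  by move=> mA; rewrite area_affine_map// detT ?oner_eq0// normr1 mul1e.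
have cTK : compact (T @` K) by apply: compact_image => //; exact: affine_map_continuous.
have vTK : convex (T @` K) by exact: affine_map_convex.
have cTC : compact (T @` C) by apply: compact_image => //; exact: affine_map_continuous.
have vTC : convex (T @` C) by exact: affine_map_convex.
pose a := dot u km; pose b := dot u kM.
have ab : a < b.
  have [r r0 [r1 r2]] := interior_shift u z0K.
  have /andP[H1 H1'] := Kw _ r1; have /andP[H2 H2'] := Kw _ r2.
  have E1 : dot u (z0 + r *: u) = dot u z0 + r * n by rewrite /dot /= /GRing.scale /= /n /dot; ring.
  have E2 : dot u (z0 - r *: u) = dot u z0 - r * n by rewrite /dot /= /GRing.scale /= /n /dot; ring.
  have : 0 < r * n by rewrite mulr_gt0.
  by rewrite /a /b; lra.
have TKab k : (T @` K) k -> a <= k.1 <= b by move=> [k' Kk' <-]; rewrite T1; exact: Kw.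
have TKa : exists2 k, (T @` K) k & k.1 = a by exists (T km); [exists km|rewrite T1].
have TKb : exists2 k, (T @` K) k & k.1 = b by exists (T kM); [exists kM|rewrite T1].
have [k1 [k2 [m [TKk1 TKk2 k12 sup12]]]] := longest_chord cTK vTK ab TKa TKb.
have d0 : k1.2 - m * k1.1 < k2.2 - m * k2.1.
  pose v : plane R := (- u.2, u.1).
  have [r r0 [r1 r2]] := interior_shift v z0K.
  have [_ H1] := sup12 _ (imageP T r1); have [H2 _] := sup12 _ (imageP T r2).
  have E1 : (T (z0 + r *: v)).1 = (T (z0 - r *: v)).1.
    by rewrite !T1 /dot /= /GRing.scale /=; ring.
  have E2 : (T (z0 + r *: v)).2 - (T (z0 - r *: v)).2 = 2 * r.
    rewrite /T /= /GRing.scale /=; transitivity (2 * r * ((u.1 * u.1 + u.2 * u.2) / n)).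
      by field.
    by rewrite -/(dot u u) -/n divff// mulr1.
  by rewrite E1 in H1; lra.
have Qle : (area Q <= ((b - a) * (k2.2 - k1.2))%:E)%E.
  have := circumscribed_trapezoid ab d0 TKab TKa TKb sup12 (ex_intro2 _ _ _ TKk1 erefl) (ex_intro2 _ _ _ TKk2 erefl).
  move=> /(@circumscribed_lin (u.1 / n) (- u.2) (u.2 / n) u.1); rewrite detS oner_eq0 => /(_ isT).
  rewrite (_ : S @` (T @` K) = K); last first.
    by rewrite image_comp; under eq_imagel do [rewrite /= ST]; exact: image_id.
  move=> /Qmin/le_trans; apply.
  have mtr := measurable_trapezoid a b m (k1.2 - m * k1.1) m (k2.2 - m * k2.1).
  rewrite area_affine_map ?detS ?oner_eq0// normr1 mul1e area_trapezoid ?lerD2l//; try exact: ltW.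
  by rewrite -k12 lee_fin le_eqVlt; apply/orP; left; apply/eqP; ring.
have mK := compact_plane_measurable cK.
have TC1 : T @` C1 = left_part (T @` C) al.
  apply/seteqP; split=> [_ [c [Cc cal] <-]|_ [[c Cc <-] cal]].
    by split; [exists c|rewrite /mkset T1].
  by exists c => //; split => //; move: cal; rewrite /mkset T1.
have TC2 : T @` C2 = right_part (T @` C) (al + (b - a)).
  apply/seteqP; split=> [_ [c [Cc cal] <-]|_ [[c Cc <-] cal]].
    by split; [exists c|rewrite /mkset T1].
  by exists c => //; split => //; move: cal; rewrite /mkset T1.
have := @strip_cut_reflected R (T @` C) (T @` K) al a b k1 k2 cTC vTC cTK vTK ab TKab TKa TKb TKk1 TKk2 k12.
have H1 : exists2 c, (T @` C) c & c.1 <= al by exists (T cl); [exists cl|rewrite T1].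
have H2 : exists2 c, (T @` C) c & al + (b - a) <= c.1 by exists (T cr); [exists cr|rewrite T1].
move=> /(_ H1 H2); rewrite -TC1 -TC2 affine_opp oppr0 -!affine_minkowski.
have cC1 : compact C1 by exact: compact_half_le.
have cC2 : compact C2 by exact: compact_half_ge.
have cKo := compact_opp cK.
have mm X Y : compact X -> compact Y -> measurable (minkowski_sum X Y).
  by move=> cX cY; apply: compact_plane_measurable; exact: compact_minkowski.
rewrite !mT//; try exact: mm.
apply: le_trans; do 2!apply: leeD => //.
rewrite mulr_natl mulr2n EFinD; exact: leeD.
Qed.

End Transfer.

(** * The bound for totally separable families *)

Section Induction.
Context {R : realType}.
Implicit Types (p q t u v z : plane R) (A B C D K L Q X Y Z : set (plane R)).

Fact areaR_key : unit. Proof. by []. Qed.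

(** Finite areas as real numbers, which can be subtracted.  Locked, so that the
    integral is an atom in linear arithmetic. *)
Definition areaR A : R := locked_with areaR_key (fine (area A)).

Lemma areaR_def A : areaR A = fine (area A).
Proof. by rewrite /areaR unlock. Qed.

Lemma areaRE A : compact A -> area A = (areaR A)%:E.
Proof. by move=> cA; rewrite areaR_def fineK// ge0_fin_numE ?area_ge0 ?compact_area_fin. Qed.

Lemma le_areaR A B : compact A -> compact B -> A `<=` B -> areaR A <= areaR B.
Proof.
move=> cA cB AB; rewrite -lee_fin -!areaRE//.
by apply: le_area => //; exact: compact_plane_measurable.
Qed.

Lemma compact_circumscribed K Q : circumscribed_parallelogram K Q -> compact Q.
Proof.
move=> [p [u [v [_ -> _ _ _]]]].
have -> : parallelogram p u v = affine_map u.1 v.1 u.2 v.2 p.1 p.2 @`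
    [set x | 0 <= x.1 <= 1 /\ 0 <= x.2 <= 1].
  apply/seteqP; split=> [_ [s s01 [t t01 <-]]|_ [[s t] /= [s01 t01] <-]].
    exists (s, t); first by move: s01 t01; rewrite /= !in_itv.
    by apply: plane_eq; rewrite /= /GRing.scale /=; ring.
  exists s; first by rewrite /= in_itv.
  exists t; first by rewrite /= in_itv.
  by apply: plane_eq; rewrite /= /GRing.scale /=; ring.
by apply: compact_image; [exact: compact_box|exact: affine_map_continuous].
Qed.

(** A ball around [z] in [K], shrunk towards [y], remains in [K]. *)
Lemma interior_open_segment K (c z y : plane R) (s : R) : convex K ->
  K° z -> K y -> 0 < s -> s <= 1 ->
  (translate c K)° (c + (s *: z + (1 - s) *: y)).
Proof.
move=> /convex_setP vK /nbhs_ballP[e /= e0 eK] Ky s0 s1.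
apply/nbhs_ballP; exists (s * e); first by rewrite /= mulr_gt0.
move=> x [/= x1 x2].
pose z' := s^-1 *: (x - c - (1 - s) *: y).
have Ez' : s *: z' + (1 - s) *: y = x - c by rewrite /z' scalerA mulfV ?gt_eqF// scale1r subrK.
exists (x - c); last by rewrite addrC subrK.
rewrite -Ez'; apply: vK => //; last exact: ltW.
apply: eK; split; rewrite /ball /= -(ltr_pM2l s0) -{1}(gtr0_norm s0) -normrM.
  by move: x1; rewrite /ball /= /GRing.scale /=; congr (`|_| < _); field; rewrite gt_eqF.
by move: x2; rewrite /ball /= /GRing.scale /=; congr (`|_| < _); field; rewrite gt_eqF.
Qed.

(** A segment from an interior point to a point beyond the line would cross the
    line in an interior point. *)
Lemma line_side_lt K (c z u : plane R) (b : R) : convex K -> K° z ->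
  [set x | dot u x = b] `&` (translate c K)° = set0 ->
  dot u (c + z) < b -> forall k, K k -> dot u (c + k) <= b.
Proof.
move=> vK Kz line0 zb k Kk; rewrite leNgt; apply/negP => kb.
pose s := (dot u (c + k) - b) / (dot u (c + k) - dot u (c + z)).
have D : 0 < dot u (c + k) - dot u (c + z) by lra.
have sE : s * (dot u (c + k) - dot u (c + z)) = dot u (c + k) - b.
  by rewrite /s mulfVK// gt_eqF.
have s0 : 0 < s by rewrite divr_gt0//; lra.
have s1 : s <= 1 by rewrite ler_pdivrMr//; lra.
have : ([set x | dot u x = b] `&` (translate c K)°) (c + (s *: z + (1 - s) *: k)).
  split; last exact: interior_open_segment.
  by move: sE; rewrite /= !dotD !dotZ => sE; lra.
by rewrite line0.
Qed.

Lemma line_side K (c u : plane R) (b : R) : convex K -> K° !=set0 ->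
  [set x | dot u x = b] `&` (translate c K)° = set0 ->
  (forall k, K k -> dot u (c + k) <= b) \/ (forall k, K k -> b <= dot u (c + k)).
Proof.
move=> vK [z Kz] line0; have [zb|zb|zb] := ltgtP (dot u (c + z)) b.
- by left; exact: line_side_lt Kz line0 zb.
- right=> k Kk; rewrite -lerN2 -dotN; apply: (line_side_lt vK Kz) => //.
    rewrite -[RHS]line0; congr (_ `&` _); apply/seteqP; split=> x /=; rewrite dotN; lra.
  by rewrite dotN ltrN2.
- have : ([set x | dot u x = b] `&` (translate c K)°) (c + (1 *: z + (1 - 1) *: z)).
    split; last by apply: interior_open_segment => //; exact: interior_subset.
    by rewrite /= scale1r subrr scale0r addr0.
  by rewrite line0.
Qed.

Lemma cut_arith (n1 n2 q k a1 a2 b1 b2 d d' : R) :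
  2 * (n1 - 1) * q + 2 * k <= a1 + b1 -> 2 * (n2 - 1) * q + 2 * k <= a2 + b2 ->
  q + q + (a1 + a2) + (b1 + b2) <= d + d' + (k + k) ->
  2 * (n1 + n2 - 1) * q + 2 * k <= d + d'.
Proof. lra. Qed.

(** The hypothesis on [C] is only that it contains the centres, and not that it is
    their hull, because the two parts of [C] beyond the strip need not be hulls
    of centres. *)
Lemma separable_bound K Q C (n : nat) (c : 'I_n -> plane R) (I : {set 'I_n}) :
  convex_domain K -> min_area_circumscribed_parallelogram K Q ->
  totally_separable (fun i => translate (c i) K) ->
  compact C -> convex C -> (0 < #|I|)%N -> (forall i, i \in I -> C (c i)) ->
  2 * (#|I|%:R - 1) * areaR Q + 2 * areaR K <=
  areaR (minkowski_sum C K) + areaR (minkowski_sum C (oppset K)).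
Proof.
move=> dK Qm sep; have [cK vK [z0 z0K]] := dK.
have cKo := compact_opp cK.
have cQ := compact_circumscribed Qm.1.
have [m] := ubnP #|I|; elim: m => // m IH in I C *; rewrite ltnS => Im cC vC I0 IC.
have [I1|I1] := leqP #|I| 1.
  have -> : #|I| = 1%N by apply/eqP; rewrite eqn_leq I1.
  rewrite subrr mulr0 mul0r add0r.
  have /card_gt0P[i iI] := I0.
  have H X : compact X -> areaR X <= areaR (minkowski_sum C X).
    move=> cX; rewrite !areaR_def -(area_translate (c i) (compact_plane_measurable cX)) -!areaR_def.
    apply: le_areaR; last by move=> _ [k Kk <-]; exists (c i); [exact: IC|exists k].
    - by rewrite translateE; apply: compact_image => //; exact: affine_map_continuous.
    - exact: compact_minkowski.
  have -> : 2 * areaR K = areaR K + areaR (oppset K).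
    by rewrite !areaR_def area_opp; [ring|exact: compact_plane_measurable].
  by apply: lerD; exact: H.
have /card_gt1P[i [j [iI jI ij]]] := I1.
have [u [b [u0 Fi Fj line0]]] := sep i j (elimN eqP ij).
have K0 : K !=set0 by exists z0; exact: interior_subset.
have cdot := @dot_continuous R u.
have [km Kkm kmin] := compact_argmin K0 cK cdot.
have [kM KkM kmax] := compact_argmax K0 cK cdot.
have Kw k : K k -> dot u km <= dot u k <= dot u kM.
  by move=> Kk; rewrite kmin ?kmax.
have wpos : dot u km < dot u kM.
  have [r r0 [r1 r2]] := interior_shift u z0K.
  have /andP[H1 H1'] := Kw _ r1; have /andP[H2 H2'] := Kw _ r2.
  have : 0 < r * dot u u by rewrite mulr_gt0// dot_self_gt0.
  have E : dot u (z0 - r *: u) = dot u z0 - r * dot u u by rewrite /dot /= /GRing.scale /=; ring.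
  by move: H1' H2; rewrite E dotD dotZ; lra.
pose lo k := `[< forall x, K x -> dot u (c k + x) <= b >].
have loP k : reflect (forall x, K x -> dot u (c k + x) <= b) (lo k) by exact: asboolP.
pose I1' := [set k in I | lo k]; pose I2' := [set k in I | ~~ lo k].
have cardI : (#|I1'| + #|I2'|)%N = #|I|.
  rewrite -(cardsID [set k | lo k] I); congr (_ + _)%N; apply: eq_card => k; rewrite !inE//.
  exact: andbC.
have iI1 : i \in I1'.
  by rewrite inE iI; apply/loP => x Kx; apply: Fi; exists x.
have jI2 : j \in I2'.
  rewrite inE jI; apply/loP => H; have := H _ KkM; have : b <= dot u (c j + km).
    by apply: Fj; exists km.
  by rewrite !dotD; lra.
have I1'0 : (0 < #|I1'|)%N by apply/card_gt0P; exists i.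
have I2'0 : (0 < #|I2'|)%N by apply/card_gt0P; exists j.
(* Centres [x] with [dot u x <= al] belong to translates before the line, and
   those beyond [al] plus the width of [K] to translates after it. *)
pose al := b - dot u kM.
pose C1 := half_le u C al; pose C2 := half_ge u C (al + (dot u kM - dot u km)).
have C1I k : k \in I1' -> C1 (c k).
  rewrite inE => /andP[kI /loP/(_ _ KkM)]; rewrite dotD => H.
  by split; [exact: IC|rewrite /= /al; lra].
have C2I k : k \in I2' -> C2 (c k).
  rewrite inE => /andP[kI /loP nlo].
  have [//|/(_ _ Kkm)] := line_side vK (ex_intro _ _ z0K) (line0 k); rewrite dotD => H.
  by split; [exact: IC|rewrite /= /al; lra].
have cC1 : compact C1 by exact: compact_half_le.
have cC2 : compact C2 by exact: compact_half_ge.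
have vC1 : convex C1 by exact: convex_cut.
have vC2 : convex C2 by rewrite /C2 half_geE; exact: convex_cut.
have IH1 := IH I1' C1 _ cC1 vC1 I1'0 C1I.
have IH2 := IH I2' C2 _ cC2 vC2 I2'0 C2I.
have lt1 : (#|I1'| < m)%N by apply: leq_trans Im; rewrite -cardI -[X in (X < _)%N]addn0 ltn_add2l.
have lt2 : (#|I2'| < m)%N by apply: leq_trans Im; rewrite -cardI -[X in (X < _)%N]add0n ltn_add2r.
have := @halfplane_cut_area R K Q C u al km kM dK Qm cC vC u0 Kkm KkM Kw
  (ex_intro2 _ _ _ (IC i iI) (C1I i iI1).2) (ex_intro2 _ _ _ (IC j jI) (C2I j jI2).2).
rewrite -/C1 -/C2 !areaRE//; try exact: compact_minkowski.
rewrite -!EFinD lee_fin.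
rewrite -cardI natrD; exact: cut_arith (IH1 lt1) (IH2 lt2).
Qed.

End Induction.

(** * Monotonicity of the area increment of a Minkowski sum *)

Section Monotone.
Context {R : realType}.
Implicit Types (p q t u v x y z : plane R) (A B C D K L M Q : set (plane R)).

Lemma lee_exchange (a m d l r : \bar R) :
  (a + r <= d)%E -> (m <= l + r)%E -> (a + m <= d + l)%E.
Proof.
move=> H1 H2; apply: le_trans (leeD H1 (lexx l)).
by rewrite -addeA; apply: leeD => //; rewrite addeC.
Qed.

Lemma ler_telescope (a a' b b' c m : R) :
  a' + b <= a + b' -> a + m <= c + b -> a' + m <= c + b'.
Proof. lra. Qed.

(** The part of [M] cut off by the line, moved by the point of [C] which is extreme
    in the direction [u], is in C + M and disjoint from the sum of [C] and the
    rest of [M]. *)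
Lemma cap_increment C M u (b : R) : compact C -> C !=set0 -> compact M ->
  areaR (minkowski_sum C (half_le u M b)) + areaR M <=
  areaR (minkowski_sum C M) + areaR (half_le u M b).
Proof.
move=> cC C0 cM; have cL : compact (half_le u M b) by exact: compact_half_le.
have [c Cc cmax] := compact_argmax C0 cC (@dot_continuous R u).
have mM := compact_plane_measurable cM; have mL := compact_plane_measurable cL.
have mCap := measurableD mM mL.
have cCL := compact_minkowski cC cL; have cCM := compact_minkowski cC cM.
have mCL := compact_plane_measurable cCL; have mCM := compact_plane_measurable cCM.
have H1 : (area (minkowski_sum C (half_le u M b)) + area (M `\` half_le u M b)
    <= area (minkowski_sum C M))%E.
  rewrite -(area_translate c mCap); apply: le_area_disjoint => //.
  - exact: measurable_translate.
  - by move=> _ [c' Cc' [k [Mk _] <-]]; exists c' => //; exists k.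
  - by move=> _ [k [Mk _] <-]; exists c => //; exists k.
  - apply/seteqP; split=> // _ [[c' Cc' [k [Mk kb] <-]] [k' [Mk' nk'] E]].
    apply: nk'; split => //.
    have := congr1 (dot u) E; rewrite !dotD; have := cmax _ Cc'; move: kb; rewrite /=; lra.
have H2 : (area M <= area (half_le u M b) + area (M `\` half_le u M b))%E.
  apply: le_trans (le_areaU mL mCap); apply: le_area => //; first exact: measurableU.
  by move=> x Mx; have [Lx|Lx] := pselect (half_le u M b x); [left|right].
have := lee_exchange H1 H2.
by rewrite (areaRE cCL) (areaRE cM) (areaRE cCM) (areaRE cL) -!EFinD lee_fin.
Qed.

(** [v] points from the nearest point of [L] to [x]. *)
Lemma separation L x : compact L -> convex L -> L !=set0 -> ~ L x ->
  exists2 v, v != 0 & forall k, L k -> dot v k <= dot v x - dot v v.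
Proof.
move=> cL vL L0 nLx.
pose g (y : plane R) : R := (y.1 - x.1) * (y.1 - x.1) + (y.2 - x.2) * (y.2 - x.2).
have cg : continuous g.
  move=> y; apply: cvgD; apply: cvgM; apply: cvgB; try exact: cvg_cst;
    solve [exact: fst_continuous | exact: snd_continuous].
have [l Ll lmin] := compact_argmin L0 cL cg.
exists (x - l).
  by rewrite subr_eq0; apply: contra_notN nLx => /eqP ->.
move=> k Lk; rewrite lerBrDr -dotD -subr_ge0.
set de := dot (x - l) (k - l); pose N := dot (k - l) (k - l).
have deE : dot (x - l) x - dot (x - l) (k + (x - l)) = - de by rewrite /de /dot /=; ring.
rewrite deE oppr_ge0 leNgt; apply/negP => de0.
have N0 : 0 <= N by rewrite /N /dot addr_ge0// sqr_ge0.
pose s := de / (de + N).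
have dN0 : 0 < de + N by lra.
have sE : s * (de + N) = de by rewrite /s mulfVK// gt_eqF.
have s0 : 0 < s by rewrite divr_gt0.
have s1 : s <= 1 by rewrite ler_pdivrMr//; lra.
have := lmin _ ((convex_setP L).1 vL k l s Lk Ll (ltW s0) s1).
have -> : g (s *: k + (1 - s) *: l) = g l - s * (2 * de - s * N).
  by rewrite /g /de /N /dot /= /GRing.scale /=; ring.
have : 0 < s * (2 * de - s * N).
  apply: mulr_gt0 => //; have : 0 <= s * de by rewrite mulr_ge0// ltW.
  by move: sE; rewrite mulrDr; lra.
lra.
Qed.

Definition rat_direction (n : nat) : plane R :=
  if (unpickle n : option (rat * rat)) is Some r then (ratr r.1, ratr r.2) else 0.

(** On the bounded set [L] a strict separation survives a small change of
    direction. *)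
Lemma rat_separation L x : compact L -> convex L -> L !=set0 -> ~ L x ->
  exists n, forall k, L k -> dot (rat_direction n) k < dot (rat_direction n) x.
Proof.
move=> cL vL L0 nLx; have [v v0 Hv] := separation cL vL L0 nLx.
have vv0 : 0 < dot v v by exact: dot_self_gt0.
have [M M0 HM] := plane_bounded cL.
pose N := M + `|x.1| + `|x.2|.
have N0 : 0 < N by rewrite /N; have := normr_ge0 x.1; have := normr_ge0 x.2; lra.
pose e := dot v v / (4 * N).
have eE : e * (4 * N) = dot v v by rewrite /e mulfVK// gt_eqF// mulr_gt0.
have e0 : 0 < e by rewrite divr_gt0// mulr_gt0.
have [r1 r1P] := @rat_in_itvoo R (v.1 - e) (v.1 + e) ltac:(lra).
have [r2 r2P] := @rat_in_itvoo R (v.2 - e) (v.2 + e) ltac:(lra).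
exists (pickle (r1, r2)) => k Lk; rewrite /rat_direction pickleK.
have := Hv _ Lk; rewrite -subr_lt0.
set w := (ratr r1, ratr r2) => Hk.
have -> : dot w k - dot w x = dot v k - dot v x + ((ratr r1 - v.1) * (k.1 - x.1) + (ratr r2 - v.2) * (k.2 - x.2)).
  by rewrite /dot /=; ring.
have small (a b : R) : `|a| <= e -> `|b| <= N -> a * b <= e * N.
  move=> ae bN; apply: (le_trans (ler_norm _)); rewrite normrM; exact: ler_pM.
have [k1 k2] := HM _ Lk.
have H1 := small (ratr r1 - v.1) (k.1 - x.1).
have H2 := small (ratr r2 - v.2) (k.2 - x.2).
have {}H1 : (ratr r1 - v.1) * (k.1 - x.1) <= e * N.
  apply: H1; first by move: r1P; rewrite in_itv /= ler_norml => /andP[? ?]; apply/andP; split; lra.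
  by apply: (le_trans (ler_normB _ _)); rewrite /N; have := normr_ge0 x.2; lra.
have {}H2 : (ratr r2 - v.2) * (k.2 - x.2) <= e * N.
  apply: H2; first by move: r2P; rewrite in_itv /= ler_norml => /andP[? ?]; apply/andP; split; lra.
  by apply: (le_trans (ler_normB _ _)); rewrite /N; have := normr_ge0 x.1; lra.
lra.
Qed.

(** [L] is obtained from [M] by countably many cuts along supporting lines of
    rational direction.  The area of C + L is at most that of the sum of [C] and
    any set of the decreasing sequence, so only the areas of the sets themselves
    pass to the limit. *)
Lemma minkowski_area_increment C L M : compact C -> C !=set0 ->
  compact L -> convex L -> L !=set0 -> compact M -> L `<=` M ->
  areaR (minkowski_sum C L) + areaR M <= areaR (minkowski_sum C M) + areaR L.
Proof.
move=> cC C0 cL vL L0 cM LM.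
have maxL n : exists t, L t /\ forall k, L k -> dot (rat_direction n) k <= dot (rat_direction n) t.
  by have [t Lt tm] := compact_argmax L0 cL (@dot_continuous R (rat_direction n)); exists t.
have [t Ht] := choice maxL.
pose F := fix F (n : nat) : set (plane R) :=
  if n is n'.+1 then half_le (rat_direction n') (F n') (dot (rat_direction n') (t n')) else M.
have cF n : compact (F n) by elim: n => // n IH; exact: compact_half_le.
have LF n : L `<=` F n.
  by elim: n => // n IH x Lx; split; [exact: IH|exact: (Ht n).2].
have incr n : areaR (minkowski_sum C (F n)) + areaR M <= areaR (minkowski_sum C M) + areaR (F n).
  elim: n => [//|n IH].
  exact: ler_telescope (cap_increment _ _ cC C0 (cF n)) IH.
have capF : \bigcap_n F n = L.
  apply/seteqP; split=> [x Fx|x Lx n _]; last exact: LF.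
  apply: contrapT => nLx; have [n Hn] := rat_separation cL vL L0 nLx.
  have [_ /=] := Fx n.+1 I; rewrite leNgt => /negP; apply; apply: Hn.
  exact: (Ht n).1.
have mF n : measurable (F n) by exact: compact_plane_measurable.
have Fdec : nonincreasing_seq F.
  apply/nonincreasing_seqP => n; apply/subsetPset => x []; by [].
have F0fin : (area (F 0%N) < +oo)%E by exact: compact_area_fin.
have lim : area (F n) @[n --> \oo] --> area L.
  rewrite -capF; apply: nonincreasing_cvg_mu => //.
  exact: bigcapT_measurable.
have bound n : ((areaR (minkowski_sum C L) + areaR M - areaR (minkowski_sum C M))%:E <= area (F n))%E.
  rewrite areaRE// lee_fin lerBlDl.
  apply: le_trans (incr n); rewrite lerD2r; apply: le_areaR.
  - exact: compact_minkowski.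
  - exact: compact_minkowski.
  - by move=> _ [c Cc [k Lk <-]]; exists c => //; exists k => //; exact: LF.
have : ((areaR (minkowski_sum C L) + areaR M - areaR (minkowski_sum C M))%:E <= area L)%E.
  rewrite -(cvg_lim _ lim)//; apply: lime_ge; first by apply: cvgP lim.
  by near=> n; exact: bound.
by rewrite areaRE// lee_fin lerBlDl.
Unshelve. all: by end_near.
Qed.

End Monotone.

(** * Comparing a body with its reflection *)

Section Triangle.
Context {R : realType}.
Implicit Types (p q t u v x y z : plane R) (A B C D K L M Q X Y Z : set (plane R)).

Notation lin a b c d := (affine_map a b c d 0 0).

Definition hseg : set (plane R) := [set p | 0 <= p.1 <= 1 /\ p.2 = 0].
(** The triangle with vertices (0, 0), (s, 0) and (0, s). *)
Definition corner (s : R) : set (plane R) := trapezoid 0 s 0 0 (-1) s.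

Lemma compact_vseg : compact (@vseg R).
Proof.
have -> : @vseg R = [set p | 0 <= p.1 <= 0 /\ 0 <= p.2 <= 1].
  by apply/seteqP; split=> p /= [H1 H2]; split => //; [rewrite H1 lexx|apply/eqP; rewrite eq_le andbC].
exact: compact_box.
Qed.

Lemma compact_hseg : compact hseg.
Proof.
have -> : hseg = [set p | 0 <= p.1 <= 1 /\ 0 <= p.2 <= 0].
  by apply/seteqP; split=> p /= [H1 H2]; split => //; [rewrite H2 lexx|apply/eqP; rewrite eq_le andbC].
exact: compact_box.
Qed.

Lemma compact_corner (s : R) : compact (corner s).
Proof.
have -> : corner s = [set p : plane R | 0 <= p.1 <= s /\ 0 <= p.2 <= s]
    `&` [set p | 1 * p.1 + 1 * p.2 <= s].
  apply/seteqP; split=> p; first by move=> [*]; split; [split; apply/andP; split; lra|rewrite /=; lra].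
  by move=> [[/andP[? ?] /andP[? ?]] /= ?]; split; lra.
by apply: compact_cut; exact: compact_box.
Qed.

Lemma convex_hseg : convex hseg.
Proof.
apply/convex_setP => p q s [/andP[p2 p3] p1] [/andP[q2 q3] q1] s0 s1; split; last first.
  by rewrite /= /GRing.scale /= p1 q1; ring.
by rewrite /= /GRing.scale /=; apply/andP; split; nra.
Qed.

Lemma convex_corner (s : R) : convex (corner s).
Proof.
apply/convex_setP => p q r [p1 p2 p3 p4] [q1 q2 q3 q4] r0 r1.
by split; rewrite /= /GRing.scale /=; nra.
Qed.

Lemma areaR_corner (s : R) : 0 < s -> areaR (corner s) = s * s / 2.
Proof.
by move=> s0; rewrite !areaR_def area_trapezoid /=; lra.
Qed.

Lemma areaR_translate p X : measurable X -> areaR (translate p X) = areaR X.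
Proof. by move=> mX; rewrite !areaR_def area_translate. Qed.

Lemma compact_translate p X : compact X -> compact (translate p X).
Proof.
by move=> cX; rewrite translateE; apply: compact_image => //; exact: affine_map_continuous.
Qed.

Lemma minkowski_translate p A B : minkowski_sum A (translate p B) = translate p (minkowski_sum A B).
Proof.
apply/seteqP; split=> [_ [a Aa [_ [b Bb <-] <-]]|_ [_ [a Aa [b Bb <-]] <-]].
  by exists (a + b); [exists a => //; exists b|rewrite addrCA].
by exists a => //; exists (p + b); [exists b|rewrite addrCA].
Qed.

Lemma overlap_arith (d v w x y' z' : R) (y z : \bar R) :
  (v%:E + y <= y'%:E)%E -> (w%:E + z <= z'%:E)%E -> (d%:E <= x%:E + y + z)%E ->
  (0 <= y)%E -> (0 <= z)%E -> d + v + w <= x + y' + z'.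
Proof.
move=> H1 H2 H3; move: y z H1 H2 H3 => [y| |] [z| |] //=.
by rewrite -!EFinD !lee_fin => *; lra.
Qed.

(** Inclusion and exclusion when only the overlaps of [X] with [Y] and [Z] are
    known. *)
Lemma areaR_union_overlap X Y Z V W D : compact X -> compact Y -> compact Z ->
  compact V -> compact W -> compact D ->
  D `<=` X `|` Y `|` Z -> V `<=` X `&` Y -> W `<=` X `&` Z ->
  areaR D + areaR V + areaR W <= areaR X + areaR Y + areaR Z.
Proof.
move=> cX cY cZ cV cW cD DU VXY WXZ.
have mC A : compact A -> measurable A by exact: compact_plane_measurable.
have mX := mC _ cX; have mYX := measurableD (mC _ cY) mX; have mZX := measurableD (mC _ cZ) mX.
have HY : (area V + area (Y `\` X) <= area Y)%E.
  apply: (le_area_disjoint (mC _ cV) mYX (mC _ cY)); [by move=> p /VXY[]|by move=> p []|].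
  by apply/seteqP; split=> [p|//] [/VXY[Xp _] [_ nXp]].
have HZ : (area W + area (Z `\` X) <= area Z)%E.
  apply: (le_area_disjoint (mC _ cW) mZX (mC _ cZ)); [by move=> p /WXZ[]|by move=> p []|].
  by apply/seteqP; split=> [p|//] [/WXZ[Xp _] [_ nXp]].
have HD : (area D <= area X + area (Y `\` X) + area (Z `\` X))%E.
  have mU := measurableU _ _ mX mYX.
  apply: (@le_trans _ _ (area (X `|` (Y `\` X) `|` (Z `\` X)))).
    apply: le_area; [exact: mC|exact: measurableU|].
    move=> p /DU Hp; have [Xp|Xp] := pselect (X p); first by left; left.
    by case: Hp => [[//|Yp]|Zp]; [left; right|right].
  by apply: (le_trans (le_areaU mU mZX)); apply: leeD => //; exact: le_areaU.
move: HY HZ HD; rewrite (areaRE cX) (areaRE cY) (areaRE cZ) (areaRE cV) (areaRE cW) (areaRE cD).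
by move=> HY HZ HD; exact: overlap_arith HY HZ HD (area_ge0 _) (area_ge0 _).
Qed.

Lemma corner_arith (t2 t1 c w h : R) :
  t2 + (c + w) + h <= h + (w + 1) + t1 + t1 -> t2 + c <= 2 * t1 + 1.
Proof. lra. Qed.

(** The triangle [corner 2] is a unit square together with two translates of
    [corner 1], which share with it a vertical and a horizontal side.  The square
    is the sum of these two segments, and by [area_add_vseg] the area added to
    [C] by the vertical one is the horizontal width [w] of [C], while the area it
    adds to C plus the horizontal one is w + 1. *)
Lemma corner_double C : compact C -> convex C -> C !=set0 ->
  areaR (minkowski_sum C (corner 2)) + areaR C <= 2 * areaR (minkowski_sum C (corner 1)) + 1.
Proof.
move=> cC vC C0.
have [p Cp pm] := compact_argmin C0 cC (@fst_continuous R).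
have [q Cq qM] := compact_argmax C0 cC (@fst_continuous R).
have cV := compact_vseg; have cH := compact_hseg; have cT1' := @compact_corner 1; have cT2' := @compact_corner 2.
have cCH := compact_minkowski cC cH.
have vCH := convex_minkowski vC convex_hseg.
have wV : areaR (minkowski_sum C vseg) = areaR C + (q.1 - p.1).
  apply: EFin_inj; rewrite EFinD -!areaRE//; last exact: compact_minkowski.
  apply: area_add_vseg => //; [by exists p|by exists q|].
  by move=> c Cc; rewrite pm ?qM.
have wHV : areaR (minkowski_sum (minkowski_sum C hseg) vseg) = areaR (minkowski_sum C hseg) + (q.1 + 1 - p.1).
  apply: EFin_inj; rewrite EFinD -!areaRE//; last exact: compact_minkowski.
  apply: area_add_vseg => //.
  - exists p => //; exists p => //; exists 0; last by rewrite addr0.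
    by split => //=; rewrite lexx ler01.
  - exists (q + (1, 0)) => //; exists q => //; exists (1, 0) => //.
    by split => //=; rewrite lexx ler01.
  - move=> _ [c Cc [h [/andP[h0 h1] _] <-]] /=; have := pm _ Cc; have := qM _ Cc.
    by move=> ? ?; apply/andP; split; lra.
have cHV := compact_minkowski cCH cV.
have cT1 := compact_minkowski cC cT1'.
have cS p' X : compact X -> compact (translate p' X) by exact: compact_translate.
have HVP (s t : R) : 0 <= s -> s <= 1 -> 0 <= t -> t <= 1 -> forall c, C c ->
    minkowski_sum (minkowski_sum C hseg) vseg (c + (s, t)).
  move=> s0 s1 t0 t1 c Cc; exists (c + (s, 0)).
    by exists c => //; exists (s, 0) => //; split => //=; apply/andP.
  exists (0, t); first by split => //=; apply/andP.
  by apply: plane_eq => /=; ring.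
have := @areaR_union_overlap (minkowski_sum (minkowski_sum C hseg) vseg)
  (translate (1, 0) (minkowski_sum C (corner 1))) (translate (0, 1) (minkowski_sum C (corner 1)))
  (translate (1, 0) (minkowski_sum C vseg)) (translate (0, 1) (minkowski_sum C hseg))
  (minkowski_sum C (corner 2)) cHV (cS _ _ cT1) (cS _ _ cT1)
  (cS _ _ (compact_minkowski cC cV)) (cS _ _ cCH)
  (compact_minkowski cC cT2').
have mT1 := compact_plane_measurable cT1.
have mCH := compact_plane_measurable cCH.
have mCV := compact_plane_measurable (compact_minkowski cC cV).
rewrite !areaR_translate// wHV wV => H.
apply: (corner_arith (w := q.1 - p.1) (h := areaR (minkowski_sum C hseg))).
rewrite (_ : q.1 - p.1 + 1 = q.1 + 1 - p.1); last by ring.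
apply: H.
- move=> _ [c Cc [[s t] [/= s0 s2 t0 t2] <-]].
  have [s1|s1] := leP s 1; last first.
    left; right; exists (c + (s - 1, t)); last by apply: plane_eq => /=; ring.
    by exists c => //; exists (s - 1, t) => //; clear -s0 s2 t0 t2 s1; split => /=; lra.
  have [t1|t1] := leP t 1; last first.
    right; exists (c + (s, t - 1)); last by apply: plane_eq => /=; ring.
    by exists c => //; exists (s, t - 1) => //; clear -s0 s2 t0 t2 t1; split => /=; lra.
  by left; left; apply: HVP => //; clear -t0; lra.
- move=> _ [_ [c Cc [[s t] [/= -> /andP[t0 t1]] <-]] <-]; split.
    rewrite (_ : (1, 0) + _ = c + (1, t)); last by apply: plane_eq => /=; ring.
    by apply: HVP.
  exists (c + (0, t)) => //; exists c => //; exists (0, t) => //.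
  by clear -t0 t1; split => /=; lra.
- move=> _ [_ [c Cc [[s t] [/= /andP[s0 s1] ->] <-]] <-]; split.
    rewrite (_ : (0, 1) + _ = c + (s, 1)); last by apply: plane_eq => /=; ring.
    by apply: HVP.
  exists (c + (s, 0)) => //; exists c => //; exists (s, 0) => //.
  by clear -s0 s1; split => /=; lra.
Qed.

Lemma reflection_arith (t1 t2 c k ck ck' : R) :
  t2 + c <= 2 * t1 + 1 -> ck' + 2 * 2 / 2 <= t2 + k -> t1 + k <= ck + 1 * 1 / 2 ->
  c + k + ck' <= 2 * ck.
Proof. lra. Qed.

(** The reflected body, moved by (1, 1), is in [corner 2], and [K] contains
    [corner 1]. *)
Lemma normalized_reflection_bound C K : compact C -> convex C -> C !=set0 ->
  compact K -> convex K -> K (0, 0) -> K (1, 0) -> K (0, 1) ->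
  (forall k, K k -> [/\ k.1 <= 1, k.2 <= 1 & 0 <= k.1 + k.2]) ->
  areaR C + areaR K + areaR (minkowski_sum C (oppset K)) <= 2 * areaR (minkowski_sum C K).
Proof.
move=> cC vC C0 cK vK K00 K10 K01 Kb.
have cKo := compact_opp cK; have vKo := convex_opp vK.
have T1K : corner 1 `<=` K.
  move=> [s t] [/= s0 s1 t0 t1].
  have [s1'|s1'] := eqVneq s 1.
    by rewrite (_ : (s, t) = (1, 0)) //; apply: plane_eq => /=; lra.
  have Ks : K (s, 0) by apply: (convex_at vK K10 K00 s0 s1) => /=; ring.
  have r0 : 0 < 1 - s by rewrite subr_gt0 lt_neqAle s1'.
  have Kt : K (s, 1 - s) by apply: (convex_at vK K10 K01 s0 s1) => /=; ring.
  by apply: (between_y vK Ks Kt); lra.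
pose L := translate (1, 1) (oppset K).
have cL : compact L by exact: compact_translate.
have vL : convex L by rewrite /L translateE; exact: affine_map_convex.
have LT : L `<=` corner 2.
  by move=> _ [_ [k Kk <-] <-]; have [? ? ?] := Kb _ Kk; split => /=; lra.
have L0 : L !=set0 by exists ((1, 1) + - (0, 0)); exists (- (0, 0)) => //; exists (0, 0).
have T10 : corner 1 !=set0 by exists (0, 0); split => /=; lra.
have := minkowski_area_increment cC C0 (@compact_corner 1) (@convex_corner 1) T10 cK T1K.
have := minkowski_area_increment cC C0 cL vL L0 (@compact_corner 2) LT.
have := corner_double cC vC C0.
have mKo := compact_plane_measurable cKo.
have mCKo := compact_plane_measurable (compact_minkowski cC cKo).
rewrite /L minkowski_translate (areaR_translate _ mCKo) (areaR_translate _ mKo).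
rewrite (areaR_corner ltr01) (areaR_corner (ltr0Sn _ 1)).
have -> : areaR (oppset K) = areaR K.
  by rewrite !areaR_def area_opp//; exact: compact_plane_measurable.
exact: reflection_arith.
Qed.

Definition det3 (v0 v1 v2 : plane R) : R :=
  (v1.1 - v0.1) * (v2.2 - v0.2) - (v2.1 - v0.1) * (v1.2 - v0.2).

Lemma largest_triangle K : compact K -> K !=set0 ->
  exists v0 v1 v2, [/\ K v0, K v1, K v2 &
    forall w0 w1 w2, K w0 -> K w1 -> K w2 -> det3 w0 w1 w2 <= det3 v0 v1 v2].
Proof.
move=> cK [z Kz].
have cKKK : compact ((K `*` K) `*` K) by do 2!apply: compact_setX => //.
pose f (w : (plane R * plane R) * plane R) := det3 w.1.1 w.1.2 w.2.
have c11 : continuous (fun w : (plane R * plane R) * plane R => w.1.1).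
  move=> w; apply: (@continuous_comp _ _ _ fst fst); exact: cvg_fst.
have c12 : continuous (fun w : (plane R * plane R) * plane R => w.1.2).
  move=> w; apply: (@continuous_comp _ _ _ fst snd); [exact: cvg_fst|exact: cvg_snd].
have c2 : continuous (fun w : (plane R * plane R) * plane R => w.2).
  by move=> w; exact: cvg_snd.
have c1x (g : (plane R * plane R) * plane R -> plane R) : continuous g -> continuous (fun w => (g w).1).
  move=> cg w; apply: (@continuous_comp _ _ _ g fst); [exact: cg|exact: cvg_fst].
have c2x (g : (plane R * plane R) * plane R -> plane R) : continuous g -> continuous (fun w => (g w).2).
  move=> cg w; apply: (@continuous_comp _ _ _ g snd); [exact: cg|exact: cvg_snd].
have cf : continuous f.
  move=> w; apply: cvgB; apply: cvgM; apply: cvgB;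
  solve [exact: (c1x _ c11) | exact: (c1x _ c12) | exact: (c1x _ c2) | exact: (c2x _ c11)
       | exact: (c2x _ c12) | exact: (c2x _ c2)].
have n0 : ((K `*` K) `*` K) !=set0 by exists ((z, z), z).
have [[[v0 v1] v2]] := compact_EVT_max n0 cKKK (continuous_subspaceT cf).
rewrite inE => -[[/= K0 K1] K2] H; exists v0, v1, v2; split => // w0 w1 w2 W0 W1 W2.
by apply: (H ((w0, w1), w2)); rewrite inE.
Qed.

(** In a triangle of largest area in [K] every point of [K] has barycentric
    coordinates at most one.  In the affine frame of that triangle these are the
    three inequalities of [normalized_reflection_bound]. *)
Lemma reflection_bound C K : compact C -> convex C -> C !=set0 ->
  convex_domain K ->
  areaR C + areaR K + areaR (minkowski_sum C (oppset K)) <= 2 * areaR (minkowski_sum C K).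
Proof.
move=> cC vC C0 [cK vK [z zK]].
have K0 : K !=set0 by exists z; exact: interior_subset.
have [v0 [v1 [v2 [Kv0 Kv1 Kv2 vmax]]]] := largest_triangle cK K0.
set D := det3 v0 v1 v2 in vmax.
have D0 : 0 < D.
  have [r r0 [Kr _]] := interior_shift (1, 0) zK; have [s s0 [Ks _]] := interior_shift (0, 1) zK.
  apply: lt_le_trans (vmax _ _ _ (interior_subset zK) Kr Ks).
  rewrite /det3 /= /GRing.scale /= !mulr1 !mulr0 !addr0.
  by rewrite (_ : _ - _ = r * s) ?mulr_gt0//; ring.
have Dn0 : D != 0 by rewrite gt_eqF.
pose a := (v2.2 - v0.2) / D; pose b := - (v2.1 - v0.1) / D.
pose c := - (v1.2 - v0.2) / D; pose d := (v1.1 - v0.1) / D.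
pose e := - (a * v0.1 + b * v0.2); pose f := - (c * v0.1 + d * v0.2).
have dE : a * d - b * c = D^-1.
  transitivity (((v1.1 - v0.1) * (v2.2 - v0.2) - (v2.1 - v0.1) * (v1.2 - v0.2)) / D / D).
    by rewrite /a /b /c /d; field.
  by rewrite -/(det3 v0 v1 v2) -/D divff// div1r.
have dn0 : a * d - b * c != 0 by rewrite dE invr_eq0.
pose T := affine_map a b c d e f.
have mT X e' f' : compact X -> areaR (affine_map a b c d e' f' @` X) = D^-1 * areaR X.
  move=> cX; rewrite !areaR_def area_affine_map//; last exact: compact_plane_measurable.
  by rewrite dE gtr0_norm ?invr_gt0// areaRE.
have x1 p : (T p).1 = det3 v0 p v2 / D by rewrite /T /= /e /a /b /det3; field.
have x2 p : (T p).2 = det3 v0 v1 p / D by rewrite /T /= /f /c /d /det3; field.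
have H1 := @normalized_reflection_bound (lin a b c d @` C) (T @` K).
have cTC : compact (lin a b c d @` C) by apply: compact_image => //; exact: affine_map_continuous.
have cTK : compact (T @` K) by apply: compact_image => //; exact: affine_map_continuous.
have vTC : convex (lin a b c d @` C) by exact: affine_map_convex.
have vTK : convex (T @` K) by exact: affine_map_convex.
have TC0 : lin a b c d @` C !=set0 by case: C0 => p Cp; exists (lin a b c d p); exists p.
have TK1 : (T @` K) (0, 0).
  exists v0 => //; apply: plane_eq; rewrite ?x1 ?x2 /det3 /=; by field.
have TK2 : (T @` K) (1, 0).
  by exists v1 => //; apply: plane_eq; rewrite ?x1 ?x2 /= -?/D ?divff// /det3; field.
have TK3 : (T @` K) (0, 1).
  by exists v2 => //; apply: plane_eq; rewrite ?x1 ?x2 /= -?/D ?divff// /det3; field.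
have TKb k : (T @` K) k -> [/\ k.1 <= 1, k.2 <= 1 & 0 <= k.1 + k.2].
  move=> [p Kp <-]; rewrite x1 x2 -mulrDl; split.
  - by rewrite ler_pdivrMr// mul1r; exact: vmax.
  - by rewrite ler_pdivrMr// mul1r; exact: vmax.
  - apply: divr_ge0; last exact: ltW.
    have -> : det3 v0 p v2 + det3 v0 v1 p = D - det3 p v1 v2 by rewrite /D /det3; ring.
    by rewrite subr_ge0; exact: vmax.
have := H1 cTC vTC TC0 cTK vTK TK1 TK2 TK3 TKb.
rewrite /T affine_opp -!affine_minkowski !mT//; try (exact: compact_minkowski).
  rewrite -!mulrDr mulrCA ler_pM2l ?invr_gt0//.
by apply: compact_minkowski => //; exact: compact_opp.
Qed.

End Triangle.

(** * Convex hulls, and the inequalities for the hull of the centres *)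

Section Hull.
Context {R : realType}.
Implicit Types (p q t u v x y z : plane R) (A B C D K L M Q X Y Z : set (plane R)).

Definition cone x A : set (plane R) :=
  [set w.1 *: x + (1 - w.1) *: w.2 | w in `[0, 1]%classic `*` A].

Lemma compact_cone x A : compact A -> compact (cone x A).
Proof.
move=> cA; apply: continuous_compact; last first.
  by apply: compact_setX => //; exact: segment_compact.
apply: continuous_subspaceT.
have c1 : continuous (fun w : R * plane R => w.1) by move=> w; exact: cvg_fst.
have c2 : continuous (fun w : R * plane R => w.2) by move=> w; exact: cvg_snd.
have c21 : continuous (fun w : R * plane R => w.2.1).
  by move=> w; apply: (@continuous_comp _ _ _ snd fst); [exact: c2|exact: cvg_fst].
have c22 : continuous (fun w : R * plane R => w.2.2).
  by move=> w; apply: (@continuous_comp _ _ _ snd snd); [exact: c2|exact: cvg_snd].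
have comb (r : R) (g : R * plane R -> R) : continuous g ->
    continuous (fun w : R * plane R => w.1 * r + (1 - w.1) * g w).
  move=> cg w; apply: cvgD; apply: cvgM; try exact: cvg_cst; try exact: c1; try exact: cg.
  by apply: cvgB; [exact: cvg_cst|exact: c1].
by move=> w; apply: (cvg_pair (comb x.1 _ c21 w) (comb x.2 _ c22 w)).
Qed.

(** A combination of two points of the cone is again on a segment from [x],
    ending at a combination of the two end points, unless it is [x] itself. *)
Lemma convex_cone x A : convex A -> convex (cone x A).
Proof.
move=> /convex_setP vA; apply/convex_setP => _ _ s [[t y] [/= t01 Ay] <-] [[t' y'] [/= t'01 Ay'] <-] s0 s1.
move: t01 t'01; rewrite !in_itv /= => /andP[t0 t1] /andP[t'0 t'1].
pose r := s * t + (1 - s) * t'.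
have r0 : 0 <= r by rewrite /r; nra.
have r1 : r <= 1 by rewrite /r; nra.
have [rE|rn] := eqVneq r 1.
  have E1 : s * (1 - t) = 0 by apply/eqP; rewrite eq_le; apply/andP; split; [|nra]; move: rE; rewrite /r; nra.
  have E2 : (1 - s) * (1 - t') = 0 by move: rE; rewrite /r => rE; lra.
  exists (1, y); first by split=> //=; rewrite in_itv /= ler01 lexx.
  rewrite /= subrr scale0r addr0 !scalerDr !scalerA E1 E2 !scale0r !addr0 -scalerDl.
  by rewrite -[_ + _]/r rE.
have r1' : 0 < 1 - r by rewrite subr_gt0 lt_neqAle rn.
pose o := s * (1 - t) / (1 - r).
have oE : o * (1 - r) = s * (1 - t) by rewrite /o mulfVK// gt_eqF.
have o0 : 0 <= o by apply: divr_ge0; [nra|exact: ltW].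
have o1 : o <= 1 by rewrite ler_pdivrMr// /r; nra.
exists (r, o *: y + (1 - o) *: y').
  by split => /=; [rewrite in_itv /= r0|exact: vA].
have E (a b d : R) : r * a + (1 - r) * (o * b + (1 - o) * d) =
    s * (t * a + (1 - t) * b) + (1 - s) * (t' * a + (1 - t') * d).
  transitivity (r * a + o * (1 - r) * b + ((1 - r) - o * (1 - r)) * d); first by ring.
  by rewrite oE /r; ring.
by apply: plane_eq; rewrite /= /GRing.scale /= E.
Qed.

Lemma convex_hull_min A M : convex M -> A `<=` M -> convex_hull A `<=` M.
Proof. by move=> vM AM; apply: smallest_sub. Qed.

Lemma sub_convex_hull A : A `<=` convex_hull A.
Proof. exact: sub_smallest. Qed.

Lemma convex_convex_hull A : convex (convex_hull A).
Proof.
apply/convex_setP => p q s Hp Hq s0 s1 M [vM AM].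
by apply: ((convex_setP M).1 vM) => //; [exact: Hp|exact: Hq].
Qed.

(** Each further point replaces the hull by a cone over it. *)
Lemma compact_hull_seq (x : plane R) (s : seq (plane R)) :
  exists H, [/\ compact H, convex H, {subset x :: s <= H} &
   forall M, convex M -> {subset x :: s <= M} -> H `<=` M].
Proof.
elim: s x => [|y s IH] x.
  exists [set x]; split.
  - exact: compact_set1.
  - by apply/convex_setP => p q r -> -> _ _ /=; rewrite -scalerDl subrKC scale1r.
  - by move=> z; rewrite !inE => /eqP ->.
  - by move=> M _ sM z ->; apply: set_mem; apply: sM; rewrite inE.
have [H [cH vH sH Hmin]] := IH y.
exists (cone x H); split.
- exact: compact_cone.
- exact: convex_cone.
- move=> z; rewrite in_cons => /orP[/eqP ->|zs]; rewrite inE.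
    exists (1, y); last by rewrite /= subrr scale0r addr0 scale1r.
    split; first by rewrite /= in_itv /= ler01 lexx.
    by apply: set_mem; apply: sH; rewrite in_cons eqxx.
  exists (0, z); last by rewrite /= subr0 scale0r add0r scale1r.
  split; first by rewrite /= in_itv /= ler01 lexx.
  exact: set_mem (sH z zs).
- move=> M vM sM _ [[t z] [/= t01 Hz] <-].
  move: t01; rewrite in_itv /= => /andP[t0 t1].
  apply: ((convex_setP M).1 vM) => //.
    by apply: set_mem; apply: sM; rewrite in_cons eqxx.
  by apply: (Hmin M vM) => // w ws; apply: sM; rewrite in_cons ws orbT.
Qed.

Lemma compact_hull_range (n : nat) (c : 'I_n -> plane R) : (0 < n)%N ->
  compact (convex_hull (range c)).
Proof.
case: n c => // n c _.
have [H [cH vH sH Hmin]] := compact_hull_seq (c ord0) [seq c i | i <- enum 'I_n.+1].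
suff -> : convex_hull (range c) = H by [].
have inS i : c i \in c ord0 :: [seq c i | i <- enum 'I_n.+1].
  by rewrite in_cons map_f ?orbT// mem_enum.
apply/seteqP; split.
  apply: convex_hull_min => // _ [i _ <-].
  exact: set_mem (sH _ (inS i)).
apply: Hmin; first exact: convex_convex_hull.
move=> z; rewrite in_cons inE => /orP[/eqP ->|/mapP[i _ ->]]; apply: sub_convex_hull.
  by exists ord0.
by exists i.
Qed.

(** For fixed [k] in [K] the points [p] with [p + k] in a given convex set form a
    convex set. *)
Lemma hull_translates (I : Type) (c : I -> plane R) K : convex K ->
  convex_hull (\bigcup_i translate (c i) K) = minkowski_sum (convex_hull (range c)) K.
Proof.
move=> vK; apply/seteqP; split.
  apply: convex_hull_min; first by apply: convex_minkowski => //; exact: convex_convex_hull.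
  move=> _ [i _ [k Kk <-]]; exists (c i); last by exists k.
  by apply: sub_convex_hull; exists i.
move=> _ [p Cp [k Kk <-]] M [vM cM].
have : convex_hull (range c) `<=` [set p | M (p + k)].
  apply: convex_hull_min.
    apply/convex_setP => x y s Mx My s0 s1 /=.
    have -> : s *: x + (1 - s) *: y + k = s *: (x + k) + (1 - s) *: (y + k).
      by apply: plane_eq; rewrite /= /GRing.scale /=; ring.
    exact: ((convex_setP M).1 vM).
  by move=> _ [i _ <-]; apply: cM; exists i => //; exists k.
exact.
Qed.

(** If [K] is symmetric, -K is a translate of [K]; if [C] is symmetric, C - K is a
    translate of the reflection of C + K. *)
Lemma areaR_symmetric C K : compact C -> compact K ->
  centrally_symmetric K \/ centrally_symmetric C ->
  areaR (minkowski_sum C (oppset K)) = areaR (minkowski_sum C K).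
Proof.
move=> cC cK.
have mCK : measurable (minkowski_sum C K).
  by apply: compact_plane_measurable; exact: compact_minkowski.
case=> [[p Kp]|[p Cp]].
- have -> : oppset K = translate (- (p *+ 2)) K.
    apply/seteqP; split=> [_ [k Kk <-]|_ [k Kk <-]].
      by exists (p *+ 2 - k); [exact: Kp|rewrite addKr].
    by exists (p *+ 2 - k); [exact: Kp|rewrite opprB addrC].
  by rewrite minkowski_translate areaR_translate.
- have -> : minkowski_sum C (oppset K) = translate (p *+ 2) (oppset (minkowski_sum C K)).
    apply/seteqP; split=> [_ [c Cc [_ [k Kk <-] <-]]|_ [_ [_ [c Cc [k Kk <-]] <-] <-]].
      exists (- (p *+ 2 - c + k)).
        by exists (p *+ 2 - c + k) => //; exists (p *+ 2 - c); [exact: Cp|exists k].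
      by move: (p *+ 2) => w; apply: plane_eq => /=; ring.
    exists (p *+ 2 - c); first exact: Cp.
    exists (- k); first by exists k.
    by move: (p *+ 2) => w; apply: plane_eq => /=; ring.
  rewrite areaR_translate; first by rewrite !areaR_def area_opp.
  by apply: compact_plane_measurable; apply: compact_opp; exact: compact_minkowski.
Qed.

Lemma general_arith (m q k c s s' : R) : 2 * m * q + 2 * k <= s + s' -> c + k + s' <= 2 * s ->
  2 / 3 * m * q + k + 1 / 3 * c <= s.
Proof. lra. Qed.

Lemma symmetric_arith (m q k s : R) : 2 * m * q + 2 * k <= s + s -> m * q + k <= s.
Proof. lra. Qed.

End Hull.

Unset Implicit Arguments.

Theorem theorem4 (R : realType) (K Q : set (plane R)) (n : nat)
    (c : 'I_n -> plane R)
    (n_gt0 : (0 < n)%N)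
    (K_convex_domain : convex_domain K)
    (F_packing : packing (fun i => translate (c i) K))
    (F_separable : totally_separable (fun i => translate (c i) K))
    (Q_min : min_area_circumscribed_parallelogram K Q) :
  let C := convex_hull (range c) in
  [/\ area (convex_hull (\bigcup_i translate (c i) K)) =
        area (minkowski_sum C K),
      (area (minkowski_sum C K) >=
        (2 / 3 * (n%:R - 1))%:E * area Q + area K + (1 / 3)%:E * area C)%E &
      centrally_symmetric K \/ centrally_symmetric C ->
      (area (minkowski_sum C K) >=
        (n%:R - 1)%:E * area Q + area K)%E].
Proof.
move=> C; have [cK vK _] := K_convex_domain.
have cC : compact C by exact: compact_hull_range.
have vC : @convex_set R (plane R) C by exact: convex_convex_hull.
have Cc i : C (c i) by apply: sub_convex_hull; exists i.
have C0 : C !=set0 by exists (c (Ordinal n_gt0)).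
have cQ := compact_circumscribed Q_min.1.
have cCK := compact_minkowski cC cK.
have bound : 2 * (n%:R - 1) * areaR Q + 2 * areaR K <=
    areaR (minkowski_sum C K) + areaR (minkowski_sum C (oppset K)).
  have := separable_bound (I := [set: 'I_n]%SET) K_convex_domain Q_min F_separable cC vC.
  by rewrite cardsT card_ord; apply.
split.
- by rewrite hull_translates.
- rewrite (areaRE cCK) (areaRE cQ) (areaRE cK) (areaRE cC) -!EFinM -!EFinD lee_fin.
  exact: general_arith bound (reflection_bound cC vC C0 K_convex_domain).
- move=> sym; rewrite (areaRE cCK) (areaRE cQ) (areaRE cK) -!EFinM -!EFinD lee_fin.
  by rewrite (areaR_symmetric cC cK sym) in bound; exact: symmetric_arith bound.
Qed.
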